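(* Any $n$-vertex graph of treewidth $\tau\ge 1$ has a voxel representation of size $O(n\tau)$. That is, there is an absolute constant $C>0$ such that for all integers $n,\tau\ge 1$, every graph with $n$ vertices and treewidth $\tau$ has a voxel representation of size at most $C\,n\,\tau$.
   Context: All graphs are finite and simple. A voxel is a cell of the unit cube grid in 3-dimensional space; two distinct voxels are adjacent if they share a face. A blob is a nonempty finite set of voxels that is connected with respect to this adjacency. A voxel representation of a graph $G=(V,E)$ assigns to each vertex $v\in V$ a blob $B_v$ such that the blobs of distinct vertices are disjoint and, for all distinct $u,v\in V$, some voxel of $B_u$ is adjacent to some voxel of $B_v$ if and only if $uv\in E$. Its size is $\sum_{v\in V}|B_v|$. Treewidth is the usual notion: the minimum, over all tree decompositions, of the maximum bag size minus $1$. *)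

(* Defs.v *)
From mathcomp Require Import all_boot all_order all_algebra finmap.

Set Implicit Arguments.
Unset Strict Implicit.
Unset Printing Implicit Defensive.

Record sgraph := SGraph {
  vertex :> finType;
  edge : rel vertex;
  edge_sym : symmetric edge;
  edge_irrefl : irreflexive edge }.

(* A ucycle of size at most 2 is [::] or [:: x; y] with x -- y: only those of
   size at least 3 are cycles in the graph-theoretic sense. *)
Definition acyclic (G : sgraph) :=
  forall c : seq G, ucycle (@edge G) c -> size c <= 2.

Definition is_tree (G : sgraph) :=
  [/\ 0 < #|G|, forall x y : G, connect (@edge G) x y & acyclic G].

Record tree_decomposition (G : sgraph) := TreeDecomposition {
  td_tree : sgraph;
  td_treeP : is_tree td_tree;
  td_bag : td_tree -> {set G};
  td_vertex : forall v : G, exists t, v \in td_bag t;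
  td_edge : forall u v : G, edge u v ->
    exists t, (u \in td_bag t) && (v \in td_bag t);
  td_connected : forall (v : G) (s t : td_tree),
    v \in td_bag s -> v \in td_bag t ->
    connect [rel a b | [&& edge a b, v \in td_bag a & v \in td_bag b]] s t }.

(* The predecessor truncates only on the graph with no vertices. *)
Definition width (G : sgraph) (D : tree_decomposition G) : nat :=
  (\max_(t : td_tree D) #|td_bag t|).-1.

Definition is_treewidth (G : sgraph) (k : nat) : Prop :=
  (exists D : tree_decomposition G, width D = k) /\
  (forall D : tree_decomposition G, k <= width D).

(* The triple (x, y, z) stands for the cell [x, x+1] * [y, y+1] * [z, z+1]. *)
Definition voxel : choiceType := (int * int * int)%type.

(* Two cells share a face iff their coordinates agree in two directions and
   differ by one in the third, i.e. iff they are at l1-distance 1. *)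
Definition voxel_adj : rel voxel := fun a b =>
  absz (a.1.1 - b.1.1)%R + absz (a.1.2 - b.1.2)%R + absz (a.2 - b.2)%R == 1.

Definition voxel_connected (B : {fset voxel}) : Prop :=
  forall a b : voxel, a \in B -> b \in B ->
  exists p : seq voxel,
    [/\ path voxel_adj a p, {subset p <= B} & last a p = b].

Definition blob (B : {fset voxel}) : Prop :=
  B != fset0 /\ voxel_connected B.

Definition blobs_touch (A B : {fset voxel}) : Prop :=
  exists a b : voxel, [/\ a \in A, b \in B & voxel_adj a b].

Definition voxel_representation (G : sgraph) (B : G -> {fset voxel}) : Prop :=
  [/\ forall v : G, blob (B v),
      forall u v : G, u != v -> fdisjoint (B u) (B v)
    & forall u v : G, u != v -> (blobs_touch (B u) (B v) <-> edge u v)].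

Definition representation_size (G : sgraph) (B : G -> {fset voxel}) : nat :=
  \sum_(v : G) #|` B v|.

(* Main.v *)
(* Let M = O(tau) bound the bags.  An elimination order obtained by rooting the tree
   decomposition yields a binary tree with one node per vertex, whose bags form a
   decomposition of width O(M) in which every edge uv is witnessed at the node of u or
   at that of v.  A piece of this tree is a subtree minus a subtree; at most two bags
   separate it from the rest, and removing one or two nodes splits it into at most five
   pieces of at most half its size.  Recursively, a piece is drawn in a box: the bag of
   the removed nodes (with the boundary of the piece) is coloured injectively, each of
   its vertices runs as a wire along the bottom edge of the box at the height given by
   its colour, and the transposed drawings of the smaller pieces are attached to this
   bundle of wires side by side, together with a spine for each removed node, which
   grows teeth towards the wires of its neighbours.  Since the boxes are transposed at
   each level, the side of the box of a piece with m nodes is O(m^a) with a < 1, so the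
   total length of all bundles is O(n), and each bundle has O(M) wires. *)

Require Import Defs.
From mathcomp Require Import all_boot finmap.
From mathcomp Require Import ssrint zify.

Set Implicit Arguments.
Unset Strict Implicit.
Unset Printing Implicit Defensive.

(** * Rooting a tree and ordering the vertices of a tree decomposition *)

Lemma acyclic_no_detour (G : sgraph) (t s q : G) :
  acyclic G -> edge t s -> edge q t ->
  connect [rel a b | [&& edge a b, a != t & b != t]] s q -> s = q.
Proof.
move=> acG ets eqt /connectP[p0 p0P]; case: (shortenP p0P) => p pP unp _ q_last.
apply/eqP; apply: contraT => sq.
have tNp : t \notin s :: p.
  rewrite inE negb_or; apply/andP; split.
    by apply: contraL ets => /eqP ->; rewrite edge_irrefl.
  have {pP}: path [rel a b | [&& edge a b, a != t & b != t]] s p by [].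
  elim: p {unp q_last} s {p0 p0P ets sq} => //= y p IH s /andP[/and3P[_ _ yt] pP].
  by rewrite inE negb_or eq_sym yt (IH _ pP).
(* Closed up through [t], the simple path from [s] to [q] is a cycle on [size p + 2] vertices, so
   acyclicity leaves only [p = [::]]. *)
have uc : ucycle (@edge G) [:: t, s & p].
  rewrite /ucycle /= rcons_path -q_last eqt andbT.
  move: (unp) tNp => /= /andP[-> ->] ->; rewrite ets !andbT /=.
  by apply: sub_path pP => a b /= /and3P[].
have := acG _ uc; rewrite /= ltnS ltnS leqn0 size_eq0 => /eqP p0nil.
by move: sq; rewrite q_last p0nil eqxx.
Qed.

(** Let [d] be the distance to an arbitrary root [r]. A neighbour of [t] that is at most as deep as
    [t] is joined to [r] off [t], and so is [par t]; by [acyclic_no_detour] the two coincide. Hence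
    every edge joins a vertex to its parent. *)
Lemma rooted_tree (T : sgraph) : is_tree T ->
  exists (d : T -> nat) (par : T -> T), forall s t : T, edge s t ->
    (s = par t /\ d t = (d s).+1) \/ (t = par s /\ d s = (d t).+1).
Proof.
case=> /card_gt0P[r _] conT acT.
pose reach (t : T) n := [exists p : n.-tuple T, path (@edge T) r p && (last r p == t)].
have reachP t : exists n, reach t n.
  have /connectP[p pP ->] := conT r t.
  by exists (size p); apply/existsP; exists (in_tuple p); rewrite /= pP eqxx.
pose d t := ex_minn (reachP t).
have dP t : exists2 p, path (@edge T) r p & last r p = t /\ size p = d t.
  rewrite /d; case: ex_minnP => n /existsP[p /andP[pP /eqP lp]] _.
  by exists p; rewrite ?size_tuple.
have d_min t p : path (@edge T) r p -> last r p = t -> d t <= size p.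
  move=> pP lp; rewrite /d; case: ex_minnP => n _; apply.
  by apply/existsP; exists (in_tuple p); rewrite /= pP lp eqxx.
have d_edge s t : edge s t -> d t <= (d s).+1.
  move=> est; have [p pP [lp <-]] := dP s.
  by rewrite -(size_rcons p t); apply: d_min; rewrite ?last_rcons // rcons_path pP lp.
have d_pred t : 0 < d t -> exists2 s, edge s t & d t = (d s).+1.
  have [p] := dP t; case/lastP: p => [|p x] pP [lp sp]; first by rewrite -sp.
  move: pP lp sp; rewrite rcons_path last_rcons size_rcons => /andP[pP ex] lp sp _.
  rewrite lp in ex; exists (last r p) => //.
  apply/eqP; rewrite eqn_leq; apply/andP; split; first by apply: d_edge; rewrite -?sp.
  by rewrite -sp ltnS; apply: d_min.
have d0 t : d t = 0 -> t = r.
  by have [p _ [lp <-]] := dP t => /size0nil p0; rewrite -lp p0.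
(* The default [t] is taken at the root only. *)
pose par t := odflt t [pick s | edge s t && (d t == (d s).+1)].
have parP t : 0 < d t -> edge (par t) t /\ d t = (d (par t)).+1.
  move=> /d_pred[s est ds]; rewrite /par; case: pickP => [q /andP[eqt /eqP]|/(_ s)] //=.
  by rewrite est ds eqxx.
(* Climbing from [x] through parents never meets [t], because the proper ancestors of [x] are less
   deep than [t]. *)
have conn_root t x : x != t -> d x <= d t ->
    connect [rel a b | [&& edge a b, a != t & b != t]] r x.
  move En: (d x) => n; elim: n => [|n IH] in x En *.
    by move=> _ _; rewrite (d0 _ En) connect0.
  move=> xt lt_n; have [|ep dp] := parP x; first by rewrite En.
  have dpn : d (par x) = n by move: dp; rewrite En => -[].
  have pt : par x != t by apply: contraTneq lt_n => <-; rewrite dpn ltnn.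
  apply: connect_trans (IH _ dpn pt (ltnW lt_n)) (connect1 _).
  by rewrite /= ep pt xt.
have par_uniq s t : edge s t -> d s <= d t -> s = par t /\ d t = (d s).+1.
  move=> est le_st.
  have neq : s != t by apply: contraTneq est => ->; rewrite edge_irrefl.
  have dt0 : 0 < d t.
    rewrite lt0n; apply: contraNneq neq => dt0; move: le_st; rewrite dt0 leqn0 => /eqP ds0.
    by rewrite (d0 _ dt0) (d0 _ ds0).
  have [ep dp] := parP t dt0.
  have pt : par t != t by apply: contraTneq ep => ->; rewrite edge_irrefl.
  suff E : s = par t by rewrite -E in dp; split.
  apply: (acyclic_no_detour (t := t) acT) => //; first by rewrite edge_sym.
  apply: connect_trans (conn_root _ _ pt _); last by rewrite dp.
  rewrite sym_connect_sym; first exact: conn_root.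
  by move=> x y /=; rewrite edge_sym; congr (_ && _); rewrite andbC.
exists d, par => s t est; case: (leqP (d s) (d t)) => le_st; first by left; apply: par_uniq.
by right; apply: par_uniq (ltnW le_st); rewrite edge_sym.
Qed.

(** A vertex is represented by [top v], the highest node whose bag contains it. If [u] and [w] share
    a bag and [u] comes first, climbing from that bag to [top u] passes [top w], so [u] lies in the
    bag at [top w]; this is the elimination property. *)
Lemma elimination_order (G : sgraph) (D : tree_decomposition G) :
  exists (key : G -> nat) (bag : G -> {set G}),
    [/\ injective key,
        forall v, v \in bag v /\ #|bag v| <= (width D).+1,
        forall u v, u \in bag v -> key u <= key v,
        forall u w v, u \in bag v -> w \in bag v -> key u <= key w -> u \in bag w
      & forall u w, edge u w -> key u <= key w -> u \in bag w].
Proof.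
have [d [par dpar]] := rooted_tree (td_treeP D).
pose tb := @td_bag G D.
have topP v : exists t, v \in tb t /\ forall s, v \in tb s -> d t <= d s.
  have [t0 t0P] := td_vertex D v.
  by case: (@arg_minnP _ t0 (fun t => v \in tb t) d t0P) => t tv tmin; exists t.
have /fin_all_exists[top topE] := topP.
have top_in v : v \in tb (top v) by case: (topE v).
have top_min v s : v \in tb s -> d (top v) <= d s by case: (topE v) => _; apply.
(* Induction along a walk from [s] to [top v] through bags containing [v]: each edge leads to the
   parent or to a child, which shifts the chain of ancestors by one. *)
have chain v s : v \in tb s ->
    (forall i, i + d (top v) <= d s -> v \in tb (iter i par s)) /\
    exists2 i, d s = i + d (top v) & iter i par s = top v.
  move=> vs; have := td_connected vs (top_in v).
  case/connectP=> p; elim: p s vs => [|s' p IH] s vs /=.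
    move=> _ <-; split; last by exists 0.
    by move=> i; rewrite -{2}[d _]add0n leq_add2r leqn0 => /eqP->.
  case/andP=> /and3P[ess' _ vs'] pP lp.
  have [H1 [i di ti]] := IH _ vs' pP lp.
  have [[sE dE]|[sE dE]] := dpar _ _ ess'.
    have i0 : 0 < i by have := top_min _ _ vs; lia.
    have H j : iter j par s = iter j.+1 par s' by rewrite iterSr -sE.
    split; first by move=> j lj; rewrite H; apply: H1; lia.
    by exists i.-1; [lia | rewrite H prednK].
  split; last by exists i.+1; [lia | rewrite iterSr -sE].
  by case=> [|j] lj //; rewrite iterSr -sE; apply: H1; lia.
(* This orders lexicographically by the depth of [top] and by [enum_rank], which is smaller than
   [#|G|]. *)
pose key v := d (top v) * #|G| + enum_rank v.
have key_d u w : key u <= key w -> d (top u) <= d (top w).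
  rewrite /key => le_uw; rewrite leqNgt; apply: contraL le_uw => lt_wu.
  rewrite -ltnNge -addnS; apply: leq_trans (leq_addr _ _).
  apply: leq_trans (leq_mul lt_wu (leqnn _)).
  by rewrite mulSn addnC leq_add2r.
have shared u w s : u \in tb s -> w \in tb s -> key u <= key w -> u \in tb (top w).
  move=> us ws /key_d luw; have [H _] := chain _ _ us.
  have [_ [i di <-]] := chain _ _ ws.
  by apply: H; lia.
exists key, (fun v => [set u in tb (top v) | key u <= key v]); split.
- move=> u w E; apply: enum_rank_inj; apply: val_inj => /=.
  have := key_d u w; have := key_d w u; rewrite E leqnn => /(_ isT) h1 /(_ isT) h2.
  have dE : d (top u) = d (top w) by lia.
  by move: E; rewrite /key dE => /addnI.
- move=> v; split; first by rewrite inE top_in leqnn.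
  apply: (@leq_trans #|tb (top v)|).
    by apply: subset_leq_card; apply/subsetP => u; rewrite inE => /andP[].
  apply: leq_trans (leqSpred _).
  exact: (@leq_bigmax _ (fun t => #|tb t|)).
- by move=> u v; rewrite inE => /andP[].
- move=> u w v; rewrite !inE => /andP[u1 u2] /andP[w1 w2] luw.
  by rewrite luw andbT; apply: shared luw; eassumption.
- move=> u w euw luw; rewrite inE luw andbT.
  by have [t /andP[ut wt]] := td_edge D euw; apply: shared luw; eassumption.
Qed.

(** * Binary trees with separating bags, and insertion of vertices into them *)

Inductive btree (V : Type) := Leaf | Node of V & btree V & btree V.
Arguments Leaf {V}.

Fixpoint nodes (V : Type) (t : btree V) : seq V :=
  if t is Node x l r then x :: nodes l ++ nodes r else [::].

Section Separated.
Variables (V : finType) (bag : V -> {set V}).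

Definition occ (s : seq V) : {set V} := \bigcup_(x <- s) bag x.

Lemma occP (s : seq V) (u : V) :
  reflect (exists2 x, x \in s & u \in bag x) (u \in occ s).
Proof.
rewrite /occ bigcup_seq.
by apply: (iffP bigcupP) => -[x]; exists x.
Qed.

Lemma occ_cons x (s : seq V) : occ (x :: s) = bag x :|: occ s.
Proof. exact: big_cons. Qed.

Lemma occ_cat (s1 s2 : seq V) : occ (s1 ++ s2) = occ s1 :|: occ s2.
Proof. exact: big_cat. Qed.

Lemma occ_sub (s1 s2 : seq V) : {subset s1 <= s2} -> occ s1 \subset occ s2.
Proof.
move=> s12; apply/subsetP => u /occP[x xs ux].
by apply/occP; exists x => //; apply: s12.
Qed.

(** Here [O] stands for the elements occurring outside the subtree. Removing a node leaves its two
    subtrees and the outside, and its bag must contain whatever two of these share. This takes the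
    place of the connectivity condition of a tree decomposition. *)
Fixpoint separated (O : {set V}) (t : btree V) : Prop :=
  if t is Node x l r then
    [/\ occ (nodes l) :&: occ (nodes r) \subset bag x,
        (occ (nodes l) :|: occ (nodes r)) :&: O \subset bag x,
        separated (O :|: bag x :|: occ (nodes r)) l
      & separated (O :|: bag x :|: occ (nodes l)) r]
  else True.

Lemma separated_weaken (O O' : {set V}) (t : btree V) :
  O' :&: occ (nodes t) \subset O -> separated O t -> separated O' t.
Proof.
elim: t O O' => //= x l IHl r IHr O O'; rewrite occ_cons occ_cat => sO [H1 H2 H3 H4].
have sO' u : u \in O' -> (u \in bag x) || (u \in occ (nodes l)) || (u \in occ (nodes r)) -> u \in O.
  by move=> uO ux; apply: (subsetP sO); rewrite !inE uO orbA.
split=> //.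
- apply/subsetP => u; rewrite !inE => /andP[lr uO]; apply: (subsetP H2).
  by rewrite !inE lr sO' // -orbA lr orbT.
- apply: IHl H3; apply/subsetP => u; rewrite !inE => /andP[/orP[/orP[uO|->]|->] ul];
    by rewrite ?orbT // sO' // ul orbT.
- apply: IHr H4; apply/subsetP => u; rewrite !inE => /andP[/orP[/orP[uO|->]|->] ul];
    by rewrite ?orbT // sO' // ul orbT.
Qed.

End Separated.

(* Left-child right-sibling encoding: the left subtree of [x] holds the
   descendants of [x], the right one its later siblings and their descendants. *)
Fixpoint insert_child (V : eqType) (p v : V) (t : btree V) : btree V :=
  if t is Node x l r then
    if x == p then Node x (Node v Leaf l) r
    else Node x (insert_child p v l) (insert_child p v r)
  else Leaf.

Lemma nodes_insert_child (V : eqType) (p v : V) (t : btree V) : uniq (nodes t) ->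
  perm_eq (nodes (insert_child p v t))
          (if p \in nodes t then v :: nodes t else nodes t).
Proof.
elim: t => //= x l IHl r IHr /andP[xlr]; rewrite cat_uniq => /and3P[ul /hasPn dis ur].
rewrite inE eq_sym; case: eqP => [_|_] /=.
  by apply/permP => a /=; rewrite !count_cat /=; lia.
have pl := IHl ul; have pr := IHr ur; rewrite mem_cat.
apply/permP => a; move/permP/(_ a): pl; move/permP/(_ a): pr.
case: (boolP (p \in nodes l)) => [/(contraL (dis p))|_].
  by move=> /negPf -> /=; rewrite !count_cat /=; lia.
by case: ifP => _ /=; rewrite !count_cat /=; lia.
Qed.

Section Insertion.
Variables (V : finType) (bag : V -> {set V}) (par : V -> V).
Variable bag2 : V -> {set V}.
Hypothesis bag2E : forall x, bag2 x = bag x :|: bag (par x).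
Let occ2 t := occ bag2 (nodes t).

(** A new child of [x] enters between [x] and its left subtree. Its [bag2] contains [bag x], so it
    separates that subtree from [bag2 x] as soon as the two share only elements of [bag x]. *)
Fixpoint left_clean (t : btree V) : Prop :=
  if t is Node x l r then
    [/\ occ2 l :&: bag2 x \subset bag x, left_clean l & left_clean r]
  else True.

Lemma occ_insert_child p v t : uniq (nodes t) -> par v = p -> bag v \subset v |: bag p ->
  occ2 (insert_child p v t) \subset (if p \in nodes t then [set v] else set0) :|: occ2 t.
Proof.
move=> ut pv bv; have := nodes_insert_child p v ut; case: ifP => pt prm.
  apply/subsetP => u /occP[x]; rewrite (perm_mem prm) inE => /predU1P[->|xt].
    rewrite bag2E !inE pv => /orP[/(subsetP bv)|up].
      rewrite !inE; case: eqP => //= _ up; apply/occP; exists p => //.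
      by rewrite bag2E inE up.
    by apply/orP; right; apply/occP; exists p => //; rewrite bag2E inE up.
  by move=> ux; rewrite inE; apply/orP; right; apply/occP; exists x.
rewrite set0U; apply: occ_sub => x; rewrite (perm_mem prm); exact.
Qed.

(** The vertex [v] is fresh, and all other elements of [bag2 v] lie in [bag p], which is part of the
    bag [bag2 p] already present. So the insertion creates no new sharing between other parts of the
    tree. *)
Lemma insert_child_separated p v t (O : {set V}) : uniq (nodes t) -> par v = p ->
  bag v \subset v |: bag p -> v \notin O -> v \notin occ2 t ->
  separated bag2 O t -> left_clean t ->
  separated bag2 O (insert_child p v t) /\ left_clean (insert_child p v t).
Proof.
move=> + pv bv; elim: t O => //= x l IHl r IHr O.
rewrite /occ2 /= occ_cons occ_cat cat_uniq !inE !negb_or.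
move=> /and3P[xlr ul /andP[/hasPn dis ur]] vO /and3P[vx vl vr] [H1 H2 H3 H4] [C1 C2 C3].
have bv2 : bag2 v \subset v |: bag p by rewrite bag2E subUset bv pv subsetUr.
case: eqP => [xp|_] /=.
  rewrite xp in H1 H2 H3 H4 C1 vx *.
  have E u : u \in occ bag2 (v :: nodes l) -> u != v -> (u \in occ bag2 (nodes l)) || (u \in bag p).
    rewrite occ_cons inE => /orP[/(subsetP bv2)|->] //; rewrite !inE.
    by case: eqP => //= _ ->; rewrite orbT.
  have bp2 u : u \in bag p -> u \in bag2 p by rewrite bag2E inE => ->.
  split; split=> //.
  - apply/subsetP => u; rewrite inE => /andP[ul2 ur2].
    have uv : u != v by apply: contraNneq vr => <-.
    case/orP: (E _ ul2 uv) => [ul3|/bp2] //.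
    by apply: (subsetP H1); rewrite inE ul3.
  - apply/subsetP => u; rewrite !(inE, in_setI) => /andP[/orP[ul2|ur2] uO].
      have uv : u != v by apply: contraNneq vO => <-.
      case/orP: (E _ ul2 uv) => [ul3|/bp2] //.
      by move/subsetP: H2 => /(_ u); rewrite !inE ul3 uO => /(_ isT).
    by move/subsetP: H2 => /(_ u); rewrite !inE ur2 uO orbT => /(_ isT).
  - split=> //.
    + by rewrite /occ big_nil set0I sub0set.
    (* What the old left subtree shares with the rest lies in [bag2 p] by separation, hence in
       [bag p] by [left_clean], hence in [bag2 v]. *)
    + rewrite {1}/occ big_nil set0U; apply/subsetP => u; rewrite inE => /andP[ul2 uO].
      suff: u \in bag p by rewrite bag2E !inE pv => ->; rewrite orbT.
      apply: (subsetP C1); rewrite inE; apply/andP; split; first exact: ul2.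
      move: uO; rewrite in_setU in_setU => /orP[/orP[uO|//]|ur2].
        by apply: (subsetP H2); rewrite inE uO andbT inE ul2.
      by apply: (subsetP H1); rewrite inE ul2.
    apply: separated_weaken H3; apply/subsetP => u.
    rewrite !(in_setI, in_setU) => /andP[+ ul2].
    have -> : u \in occ bag2 [::] = false by rewrite /occ big_nil inE.
    rewrite orbF => /orP[//|/(subsetP bv2)]; rewrite in_setU1 => /predU1P[uv|/bp2].
      by move: vl; rewrite -uv ul2.
    by move=> ->; rewrite orbT.
  - apply: separated_weaken H4; apply/subsetP => u.
    rewrite !(in_setI, in_setU) => /andP[/orP[->//|ul2] ur2].
    have uv : u != v by apply: contraNneq vr => <-.
    case/orP: (E _ ul2 uv) => [->|]; first by rewrite orbT.
    by move/bp2 => ->; rewrite orbT.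
  - apply/subsetP => u; rewrite inE => /andP[ul2 up2].
    have uv : u != v by apply: contraNneq vx => <-.
    case/orP: (E _ ul2 uv) => [ul3|] //.
    by apply: (subsetP C1); rewrite inE ul3.
  - by split=> //; rewrite /occ2 /occ big_nil set0I sub0set.
have sub c : uniq (nodes c) -> forall u, u \in occ2 (insert_child p v c) -> u != v -> u \in occ2 c.
  move=> uc u; move/(subsetP (occ_insert_child uc pv bv)); rewrite inE.
  by case: ifP; rewrite !inE; case: eqP.
have [subl subr] := (sub _ ul, sub _ ur).
pose Ol := O :|: bag2 x :|: occ2 r; pose Or := O :|: bag2 x :|: occ2 l.
have [Sl Ll] : separated bag2 Ol (insert_child p v l) /\ left_clean (insert_child p v l).
  apply: IHl => //; rewrite /Ol !in_setU !negb_or vO vr.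
  by rewrite vx.
have [Sr Lr] : separated bag2 Or (insert_child p v r) /\ left_clean (insert_child p v r).
  apply: IHr => //; rewrite /Or !in_setU !negb_or vO vl.
  by rewrite vx.
(* As [p] occurs in at most one of the two subtrees, [v] enters at most one of them and is not
   shared. *)
have lr u : u \in occ2 (insert_child p v l) -> u \in occ2 (insert_child p v r) ->
    (u \in occ2 l) && (u \in occ2 r).
  move=> u1 u2; suff uv : u != v by rewrite subl // subr.
  apply: contraTneq u1 => uv; subst u.
  have := subsetP (occ_insert_child ul pv bv) v; have := subsetP (occ_insert_child ur pv bv) v.
  rewrite u2 => /(_ isT); rewrite !in_setU /occ2 (negPf vl) (negPf vr) !orbF.
  case: ifP => [pr _|]; last by rewrite inE.
  case: ifP => [pl|_ H]; last by apply/negP => /H; rewrite inE.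
  by move: (dis _ pr); rewrite pl.
split; split=> //.
- by apply/subsetP => u; rewrite inE => /andP[u1 u2]; apply: (subsetP H1); rewrite inE lr.
- apply/subsetP => u; rewrite !(in_setI, in_setU) => /andP[u1 uO].
  have uv : u != v by apply: contraNneq vO => <-.
  apply: (subsetP H2); rewrite !(in_setI, in_setU) uO andbT.
  by case/orP: u1 => [/subl|/subr] ->; rewrite ?orbT.
- apply: separated_weaken Sl; apply/subsetP => u; rewrite /Ol !(in_setI, in_setU).
  move=> /andP[/orP[->//|u2] u1].
  by case/andP: (lr _ u1 u2) => _ ->; rewrite orbT.
- apply: separated_weaken Sr; apply/subsetP => u; rewrite /Or !(in_setI, in_setU).
  move=> /andP[/orP[->//|u2] u1].
  by case/andP: (lr _ u2 u1) => -> _; rewrite orbT.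
- apply/subsetP => u; rewrite in_setI => /andP[u1 u2].
  have uv : u != v by apply: contraNneq vx => <-.
  by apply: (subsetP C1); rewrite in_setI u2 andbT subl.
Qed.

End Insertion.

(** Vertices are inserted in the order of their keys. The parent of [v] is the latest other element
    of [bag v]; its bag contains the remaining ones by the elimination property. If there is none,
    any earlier vertex serves as parent, and the very first vertex is the root and its own
    parent. *)
Lemma binary_decomposition (G : sgraph) (D : tree_decomposition G) :
  exists (bag : G -> {set G}) (t : btree G),
    [/\ uniq (nodes t) /\ (forall x, x \in nodes t), separated bag set0 t,
        forall x, x \in bag x, forall x, #|bag x| <= 2 * (width D).+1
      & forall u v, edge u v -> (u \in bag v) || (v \in bag u)].
Proof.
have [key [bag [key_inj bagP bag_le bag_elim bag_edge]]] := elimination_order D.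
have parP v : exists p, bag v \subset v |: bag p /\
    (key p < key v \/ p = v /\ forall u, key v <= key u).
  case: (set_0Vmem (bag v :\ v)) => [b0|[u0 u0b]]; last first.
    case: (@arg_maxnP _ u0 (fun u => u \in bag v :\ v) key u0b) => p.
    rewrite in_setD1 => /andP[pv pb] pmax; exists p; split.
      apply/subsetP => u ub; rewrite in_setU1; case: eqP => //= /eqP uv.
      have le_up : key u <= key p by apply: pmax; rewrite in_setD1 uv.
      exact: bag_elim ub pb le_up.
    left; have := bag_le _ _ pb; rewrite leq_eqVlt => /predU1P[/key_inj E|//].
    by rewrite E eqxx in pv.
  have bv p : bag v \subset v |: bag p.
    apply/subsetP => u ub; rewrite in_setU1; case: eqP => //= /eqP uv.
    by have : u \in bag v :\ v; [rewrite in_setD1 uv | rewrite b0 inE].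
  case: (pickP (fun u => key u < key v)) => [p lpv|min_v]; first by exists p; split; [|left].
  by exists v; split=> //; right; split=> // u; rewrite leqNgt min_v.
have /fin_all_exists[par parE] := parP.
pose bag2 x := bag x :|: bag (par x).
have bag2_le u x : u \in bag2 x -> key u <= key x.
  rewrite inE => /orP[/bag_le //|/bag_le h]; apply: leq_trans h _.
  by case: (parE x) => _ [/ltnW|[-> _]].
have [t [ut tE st _]] : exists t, [/\ uniq (nodes t),
    forall x, (x \in nodes t) = (key x < (\max_x key x).+1), separated bag2 set0 t
    & left_clean bag bag2 t].
  elim: (\max_x _).+1 => [|n [t [ut tE st lt]]]; first by exists Leaf; split.
  case: (pickP (fun v => key v == n)) => [v /eqP kv|kn]; last first.
    by exists t; split=> // x; rewrite tE ltnS [RHS]leq_eqVlt kn.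
  have kvE x : (key x == n) = (x == v) by rewrite -kv (inj_eq key_inj).
  have vt : v \notin nodes t by rewrite tE kv ltnn.
  have [bv pv] := parE v.
  (* The elements of a bag have keys at most that of its node, so [v] occurs nowhere yet. *)
  have vocc : v \notin occ bag2 (nodes t).
    apply/negP => /occP[x]; rewrite tE -kv => lt_xv /bag2_le.
    by rewrite leqNgt lt_xv.
  case: pv => [lpv|[_ minv]]; last first.
    have t0 : nodes t =i [::].
      by move=> x; rewrite tE -kv ltnNge minv.
    exists (Node v Leaf Leaf); split=> //=.
    - by move=> x; rewrite inE ltnS [RHS]leq_eqVlt kvE -tE t0 orbF.
    - by rewrite /occ big_nil set0I setU0 set0I sub0set; split.
    - by rewrite /occ big_nil set0I sub0set; split.
  exists (insert_child (par v) v t).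
  have := nodes_insert_child (par v) v ut; rewrite tE -kv lpv => prm.
  have v0 : v \notin set0 by rewrite inE.
  have [s1 s2] := insert_child_separated (fun=> erefl) ut erefl bv v0 vocc st lt.
  split=> //; first by rewrite (perm_uniq prm) /= vt.
  by move=> x; rewrite (perm_mem prm) inE tE ltnS [RHS]leq_eqVlt -kv (inj_eq key_inj).
exists bag2, t; split=> //.
- by split=> // x; rewrite tE ltnS; apply: (@leq_bigmax _ key).
- by move=> x; rewrite inE; case: (bagP x) => ->.
- move=> x; rewrite mul2n -addnn; apply: leq_trans (leq_card_setU _ _) (leq_add _ _).
    by case: (bagP x).
  by case: (bagP (par x)).
- move=> u v euv; case/orP: (leq_total (key u) (key v)) => le_uv.
    by rewrite inE (bag_edge _ _ euv le_uv).
  by rewrite edge_sym in euv; rewrite orbC inE (bag_edge _ _ euv le_uv).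
Qed.

(** * Contexts and balanced cuts of binary trees *)

(* A context is a path of frames leading from a node down to a hole, outermost
   frame first; the frame [(b, x, s)] is the node [x] with the sibling [s] of the
   hole, which lies on the left iff [b] holds. *)
Definition fill (V : Type) (f : bool * V * btree V) (t : btree V) : btree V :=
  if f.1.1 then Node f.1.2 t f.2 else Node f.1.2 f.2 t.

Definition plug (V : Type) (C : seq (bool * V * btree V)) (t : btree V) : btree V :=
  foldr (@fill V) t C.

Definition cnodes (V : Type) (C : seq (bool * V * btree V)) : seq V :=
  flatten [seq f.1.2 :: nodes f.2 | f <- C].

Lemma cnodes_cat (V : Type) (C D : seq (bool * V * btree V)) :
  cnodes (C ++ D) = cnodes C ++ cnodes D.
Proof. by rewrite /cnodes map_cat flatten_cat. Qed.

Lemma cnodes_cons (V : Type) (f : bool * V * btree V) (C : seq (bool * V * btree V)) :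
  cnodes (f :: C) = f.1.2 :: nodes f.2 ++ cnodes C.
Proof. by []. Qed.

Lemma nodes_plug (V : eqType) (C : seq (bool * V * btree V)) (t : btree V) :
  perm_eq (nodes (plug C t)) (cnodes C ++ nodes t).
Proof.
elim: C => //= -[[b x] s] C IH; apply/permP => a; move/permP/(_ a): IH.
by rewrite /fill /cnodes /=; case: b => /=; rewrite !count_cat /= ?count_cat; lia.
Qed.

(** The context follows left children down to a leaf. Thus subtrees are contexts too, and only
    contexts need to be split. *)
Lemma context_of_tree (V : eqType) (t : btree V) :
  exists2 C, t = plug C Leaf & perm_eq (cnodes C) (nodes t).
Proof.
elim: t => [|x l [C lE _] r _]; first by exists [::].
have E : Node x l r = plug ((true, x, r) :: C) Leaf by rewrite /= -lE.
exists ((true, x, r) :: C) => //; rewrite E perm_sym.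
by have := nodes_plug ((true, x, r) :: C) Leaf; rewrite cats0.
Qed.

(** The frame [f] is the one at which the number of nodes, counted from the outermost frame, first
    exceeds [k]. *)
Lemma context_median (V : Type) (k : nat) (C : seq (bool * V * btree V)) :
  k < size (cnodes C) ->
  exists C1 f C2, [/\ C = C1 ++ f :: C2, size (cnodes C1) <= k
    & size (cnodes C2) + k < size (cnodes C)].
Proof.
elim: C k => // f C IH k; rewrite cnodes_cons /= size_cat => lt_k.
case: (leqP (size (nodes f.2)).+1 k) => le_k; last first.
  by exists [::], f, C; split=> //; lia.
have [|C1 [f' [C2 [-> h1 h2]]]] := IH (k - (size (nodes f.2)).+1); first lia.
exists (f :: C1), f', C2; split=> //; rewrite ?cnodes_cons /= ?size_cat; lia.
Qed.

(** Descend into a child subtree with more than [k] nodes as long as there is one. The subtree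
    reached still has more than [k] nodes, which bounds the context. *)
Lemma heavy_node (V : eqType) (k : nat) (t : btree V) : k < size (nodes t) ->
  exists C x l r, [/\ t = plug C (Node x l r), size (nodes l) <= k,
    size (nodes r) <= k & size (cnodes C) + k < size (nodes t)].
Proof.
elim: t => //= x l IHl r IHr; rewrite size_cat => lt_k.
case: (ltnP k (size (nodes l))) => hl.
  have [C [y [l' [r' [-> h1 h2 h3]]]]] := IHl hl.
  exists ((true, x, r) :: C), y, l', r'; split=> //.
  by rewrite cnodes_cons /= size_cat; move: h3; lia.
case: (ltnP k (size (nodes r))) => hr.
  have [C [y [l' [r' [-> h1 h2 h3]]]]] := IHr hr.
  exists ((false, x, l) :: C), y, l', r'; split=> //.
  by rewrite cnodes_cons /= size_cat; move: h3; lia.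
by exists [::], x, l, r; split.
Qed.

Lemma perm_splice (V : eqType) (x y : V) (d1 d2 s e t : seq V) :
  perm_eq s (y :: e ++ t) ->
  perm_eq (x :: d1 ++ d2 ++ s) [:: x, y & d1 ++ d2 ++ e ++ t].
Proof.
move/permP=> sE; apply/permP => a; have := sE a.
by rewrite /= !count_cat /=; lia.
Qed.

(** * Pieces of the tree, their boundaries and balanced splittings *)

Section Pieces.
Variables (V : finType) (bag : V -> {set V}) (B : btree V).
Hypothesis uniqB : uniq (nodes B).
Hypothesis fullB : forall x, x \in nodes B.
Hypothesis sepB : separated bag set0 B.
Local Notation occ := (occ bag).
Implicit Types (C D : seq (bool * V * btree V)) (t : btree V).

Definition boundary (P : {set V}) : {set V} := occ (enum P) :&: occ (enum (~: P)).

Definition is_piece (P : {set V}) :=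
  exists C D t, B = plug C (plug D t) /\ P = [set x in cnodes D].

Lemma separated_plug O C t :
  separated bag O (plug C t) -> separated bag (O :|: occ (cnodes C)) t.
Proof.
elim: C O => [|[[b x] s] C IH] O /=; first by rewrite /occ big_nil setU0.
rewrite cnodes_cons occ_cons occ_cat !setUA /fill.
by case: b => /= -[_ _ h1 h2]; apply: IH.
Qed.

Lemma frame_separates C b x s t : B = plug C (fill (b, x, s) t) ->
  [/\ occ (nodes t) :&: occ (nodes s) \subset bag x,
      occ (nodes t) :&: occ (cnodes C) \subset bag x
    & occ (nodes s) :&: occ (cnodes C) \subset bag x].
Proof.
move=> BE; have := sepB; rewrite BE => /separated_plug; rewrite set0U.
rewrite /fill; case: b {BE} => /= -[h1 h2 _ _]; split;
  rewrite // 1?setIC //; apply: subset_trans h2;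
  by rewrite 1?[_ :&: occ (cnodes C)]setIC setIS ?subsetUl ?subsetUr.
Qed.

Lemma hole_boundary M C t : (forall x, #|bag x| <= M) -> B = plug C t ->
  #|occ (nodes t) :&: occ (cnodes C)| <= M.
Proof.
move=> bagM; case/lastP: C => [_|C [[b x] s]].
  by rewrite /= /occ big_nil setI0 cards0.
rewrite -cats1 /plug foldr_cat cnodes_cat /= => /frame_separates[h1 h2 _].
apply: leq_trans (bagM x); apply: subset_leq_card.
rewrite occ_cat -/(occ _) /cnodes /= cats0 occ_cons !setIUr !subUset h2 h1.
by rewrite subsetIr.
Qed.

(** Outside a piece lie the context above it and the subtree below it; each contributes at most [M]
    elements by [hole_boundary]. *)
Lemma piece_boundary M P : (forall x, #|bag x| <= M) -> is_piece P ->
  #|boundary P| <= M + M.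
Proof.
move=> bagM [C [D [t [BE ->]]]].
have pB : perm_eq (nodes B) (cnodes C ++ (cnodes D ++ nodes t)).
  rewrite BE; apply: perm_trans (nodes_plug _ _) _.
  by rewrite perm_cat2l nodes_plug.
have BE2 : B = plug (C ++ D) t by rewrite BE /plug foldr_cat.
apply: (@leq_trans #|(occ (nodes (plug D t)) :&: occ (cnodes C)) :|:
                     (occ (nodes t) :&: occ (cnodes (C ++ D)))|).
  apply: subset_leq_card; apply/subsetP => u; rewrite in_setI => /andP[/occP[x]].
  rewrite mem_enum in_set => xD ux /occP[y]; rewrite mem_enum in_setC in_set => yD uy.
  have := fullB y; rewrite (perm_mem pB) !mem_cat (negPf yD) /= => yCt.
  rewrite in_setU !in_setI; case/orP: yCt => [yC|yt].
    have -> : u \in occ (cnodes C) by apply/occP; exists y.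
    suff -> : u \in occ (nodes (plug D t)) by [].
    by apply/occP; exists x; rewrite // (perm_mem (nodes_plug _ _)) mem_cat xD.
  have -> : u \in occ (nodes t) by apply/occP; exists y.
  suff -> : u \in occ (cnodes (C ++ D)) by rewrite orbT.
  by apply/occP; exists x; rewrite // cnodes_cat mem_cat xD orbT.
by apply: leq_trans (leq_card_setU _ _) (leq_add _ _); apply: hole_boundary.
Qed.

Lemma tree_is_piece C t : B = plug C t ->
  exists C' D t', B = plug C' (plug D t') /\ perm_eq (cnodes D) (nodes t).
Proof.
by move=> BE; have [D tE prm] := context_of_tree t; exists C, D, Leaf; rewrite -tE.
Qed.

(* The first cut balances the path of the context; a second one is applied to the
   subtree hanging off the cut node when this subtree is still too big. *)
Lemma context_split C D t : B = plug C (plug D t) -> 0 < size (cnodes D) ->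
  exists (own : seq V) (ss : seq (seq V)),
    [/\ 0 < size own <= 2 /\ size ss <= 5, perm_eq (cnodes D) (own ++ flatten ss),
        forall s, s \in ss ->
          exists C' D' t', B = plug C' (plug D' t') /\ perm_eq (cnodes D') s,
        forall s, s \in ss -> (size s).*2 <= size (cnodes D)
      & pairwise [rel s1 s2 | occ s1 :&: occ s2 \subset occ own] ss].
Proof.
move=> BE m0.
have half (s' : seq V) : size s' <= (size (cnodes D))./2 -> (size s').*2 <= size (cnodes D).
  by lia.
have plug_cat C1 C2 t' : plug (C1 ++ C2) t' = plug C1 (plug C2 t').
  by rewrite /plug foldr_cat.
have [|D1 [[[b x] s] [D2 [DE h1 h2]]]] := @context_median _ (size (cnodes D))./2 D; first lia.
have mE : size (cnodes D) = size (cnodes D1) + (size (nodes s)).+1 + size (cnodes D2).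
  by rewrite DE cnodes_cat size_cat cnodes_cons /= size_cat; lia.
have lt_sm : size (nodes s) < size (cnodes D) by lia.
have half_lt i j m : i + m./2 < j -> j < m -> i <= m./2 by lia.
have BE1 : B = plug C (plug D1 (plug ((b, x, s) :: D2) t)) by rewrite BE DE plug_cat.
have BE2 : B = plug (C ++ D1 ++ [:: (b, x, s)]) (plug D2 t).
  by rewrite BE DE -!plug_cat -!catA.
have BE3 : B = plug (C ++ D1) (fill (b, x, s) (plug D2 t)) by rewrite BE1 plug_cat.
(* Flipping the frame exchanges the hole with its sibling and turns [s] into the subtree in the
   hole. *)
have BE4 : B = plug (C ++ D1 ++ [:: (~~ b, x, plug D2 t)]) s.
  by rewrite BE3 !plug_cat /= /fill /=; case: (b).
have [sep1 sep2 sep3] := frame_separates BE3.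
have subD1 : occ (cnodes D1) \subset occ (cnodes (C ++ D1)).
  by apply: occ_sub => y; rewrite cnodes_cat mem_cat orbC => ->.
have subD2 : occ (cnodes D2) \subset occ (nodes (plug D2 t)).
  by apply: occ_sub => y; rewrite (perm_mem (nodes_plug _ _)) mem_cat => ->.
have sep12 : occ (cnodes D1) :&: occ (cnodes D2) \subset bag x.
  by apply: subset_trans sep2; rewrite setIC; apply: setISS.
have sep1s s' : {subset s' <= nodes s} -> occ (cnodes D1) :&: occ s' \subset bag x.
  by move=> s's; apply: subset_trans sep3; rewrite setIC; apply: setISS => //; apply: occ_sub.
have sep2s s' : {subset s' <= nodes s} -> occ (cnodes D2) :&: occ s' \subset bag x.
  by move=> s's; apply: subset_trans sep1; apply: setISS => //; apply: occ_sub.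
have prmD : perm_eq (cnodes D) (x :: cnodes D1 ++ cnodes D2 ++ nodes s).
  apply/permP => a; rewrite DE cnodes_cat cnodes_cons /=.
  by rewrite !(count_cat, count_cat _ (cnodes D1)) /= !count_cat; lia.
have hD2 : size (cnodes D2) <= (size (cnodes D))./2 by lia.
case: (leqP (size (nodes s)) (size (cnodes D))./2) => hs.
  exists [:: x], [:: cnodes D1; cnodes D2; nodes s]; split=> //.
  - by rewrite /= cats0.
  - move=> s'; rewrite !inE => /or3P[] /eqP->; last exact: tree_is_piece BE4.
      by do 3!eexists; split; first exact: BE1.
    by do 3!eexists; split; first exact: BE2.
  - by move=> s'; rewrite !inE => /or3P[] /eqP->; apply: half.
  - by rewrite /= occ_cons /occ big_nil setU0 -!/(occ _) sep12 sep1s // sep2s.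
(* Only [s] can exceed half of the piece. Cutting it at a heavy node [y] replaces it by [cnodes E],
   [nodes l] and [nodes r]. *)
have [E [y [l [r [sE hl hr hE]]]]] := heavy_node hs.
have sub_s : perm_eq (nodes s) (y :: cnodes E ++ nodes l ++ nodes r).
  rewrite {1}sE; apply: perm_trans (nodes_plug _ _) _.
  by rewrite -cat1s perm_sym perm_catCA.
pose F := C ++ D1 ++ [:: (~~ b, x, plug D2 t)].
have BEl : B = plug (F ++ E) (fill (true, y, r) l) by rewrite plug_cat -sE.
have BEl' : B = plug (F ++ E ++ [:: (true, y, r)]) l by rewrite BEl !plug_cat.
have BEr' : B = plug (F ++ E ++ [:: (false, y, l)]) r by rewrite BEl !plug_cat.
have [sep4 sep5 sep6] := frame_separates BEl.
have subE : occ (cnodes E) \subset occ (cnodes (F ++ E)).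
  by apply: occ_sub => z; rewrite cnodes_cat mem_cat orbC => ->.
exists [:: x; y], [:: cnodes D1; cnodes D2; cnodes E; nodes l; nodes r]; split=> //.
- by apply: perm_trans prmD _; rewrite /= cats0; apply: perm_splice.
- move=> s'; rewrite !inE => /orP[/eqP->|/orP[/eqP->|/or3P[] /eqP->]].
  + by do 3!eexists; split; first exact: BE1.
  + by do 3!eexists; split; first exact: BE2.
  + by exists F, E, (Node y l r); rewrite -sE.
  + exact: tree_is_piece BEl'.
  + exact: tree_is_piece BEr'.
- have hE' : size (cnodes E) <= (size (cnodes D))./2 by exact: half_lt hE lt_sm.
  by move=> s'; rewrite !inE => /orP[/eqP->|/orP[/eqP->|/or3P[] /eqP->]]; apply: half.
have bx : bag x \subset occ [:: x; y] by rewrite !occ_cons subsetUl.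
have by_ : bag y \subset occ [:: x; y] by rewrite !occ_cons setUCA subsetUl.
have ss1 : {subset cnodes E <= nodes s}.
  by move=> z zE; rewrite (perm_mem sub_s) inE mem_cat zE orbT.
have ss2 : {subset nodes l <= nodes s}.
  by move=> z zE; rewrite (perm_mem sub_s) inE !mem_cat zE !orbT.
have ss3 : {subset nodes r <= nodes s}.
  by move=> z zE; rewrite (perm_mem sub_s) inE !mem_cat zE !orbT.
have sep5' : occ (cnodes E) :&: occ (nodes l) \subset bag y.
  by apply: subset_trans sep5; rewrite setIC; apply: setIS.
have sep6' : occ (cnodes E) :&: occ (nodes r) \subset bag y.
  by apply: subset_trans sep6; rewrite setIC; apply: setIS.
rewrite /= !andbT (subset_trans sep12 bx) !(subset_trans (sep1s _ _) bx) //.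
rewrite !(subset_trans (sep2s _ _) bx) // (subset_trans sep4) // (subset_trans sep5') //.
by rewrite (subset_trans sep6').
Qed.

Lemma piece_full : is_piece [set: V].
Proof.
have [D BE prm] := context_of_tree B; exists [::], D, Leaf; split=> //.
by apply/setP => x; rewrite !inE (perm_mem prm) fullB.
Qed.

Lemma occ_enum (s : seq V) : occ (enum [set x in s]) = occ s.
Proof.
apply/eqP; rewrite eqEsubset; apply/andP; split; apply: occ_sub => x;
  by rewrite mem_enum inE.
Qed.

Lemma piece_split P : is_piece P -> P != set0 ->
  exists (own : seq V) (Ps : seq {set V}),
    [/\ [/\ 0 < size own <= 2, size Ps <= 5 & {subset own <= P}],
        forall A, A \in Ps ->
          [/\ is_piece A, A \subset P, #|A|.*2 <= #|P| & forall x, x \in own -> x \notin A],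
        forall x, x \in P -> x \in own \/ exists2 A, A \in Ps & x \in A,
        \sum_(A <- Ps) #|A| < #|P|
      & pairwise [rel A1 A2 : {set V} | occ (enum A1) :&: occ (enum A2) \subset occ own] Ps].
Proof.
case=> C [D [t [BE PE]]] P0.
have uD : uniq (cnodes D).
  have := uniqB; rewrite BE (perm_uniq (nodes_plug _ _)) cat_uniq => /and3P[_ _].
  by rewrite (perm_uniq (nodes_plug _ _)) cat_uniq => /andP[].
have cP : #|P| = size (cnodes D) by rewrite PE cardsE; apply/card_uniqP.
have P1 : 0 < size (cnodes D) by rewrite -cP card_gt0.
have [own [ss [[so sss] prm pc half sep]]] := context_split BE P1.
have := uD; rewrite (perm_uniq prm) cat_uniq => /and3P[uo /hasPn dis us].
have ssu s : s \in ss -> uniq s.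
  elim: ss us {sss prm pc half sep dis} => //= s' ss IH; rewrite cat_uniq inE.
  by move=> /and3P[u1 _ u2] /predU1P[->|] //; apply: IH.
have cA s : s \in ss -> #|[set x in s]| = size s.
  by move=> /ssu us'; rewrite cardsE; apply/card_uniqP.
have sF s x : s \in ss -> x \in s -> x \in flatten ss.
  by move=> h1 h2; apply/flattenP; exists s.
exists own, [seq [set x in s] | s <- ss]; split.
- by split=> //; [rewrite size_map | move=> x xo; rewrite PE inE (perm_mem prm) mem_cat xo].
- move=> A /mapP[s sss' ->]; split.
  + have [C' [D' [t' [BE' prm']]]] := pc s sss'; exists C', D', t'; split=> //.
    by apply/setP => x; rewrite !inE (perm_mem prm').
  + apply/subsetP => x; rewrite PE !inE (perm_mem prm) mem_cat => xs.
    by rewrite (sF s) ?orbT.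
  + by rewrite cP cA // half.
  + by move=> x xo; rewrite inE; apply: contraL xo => xs; apply: dis; apply: sF xs.
- move=> x; rewrite PE inE (perm_mem prm) mem_cat => /orP[->|]; first by left.
  by case/flattenP => s sss' xs; right; exists [set x in s]; rewrite ?map_f ?inE.
- rewrite big_map cP (perm_size prm) size_cat size_flatten /shape sumnE big_map.
  rewrite -[X in X < _]add0n -addSn leq_add //; first by case/andP: so.
  by rewrite big_seq [X in _ <= X]big_seq leq_sum // => s /cA ->.
- by rewrite pairwise_map; apply: sub_pairwise sep => s1 s2 /=; rewrite !occ_enum.
Qed.

End Pieces.

(** * Cells with natural coordinates and connected lists of cells *)

Definition cell := (nat * nat * nat)%type.

(** Subtraction is truncated, so the sum of the two differences is the absolute difference; this is
    l1-distance 1, as in [voxel_adj]. *)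
Definition near (a b : cell) : bool :=
  (a.1.1 - b.1.1) + (b.1.1 - a.1.1) + ((a.1.2 - b.1.2) + (b.1.2 - a.1.2))
  + ((a.2 - b.2) + (b.2 - a.2)) == 1.

Lemma near_sym : symmetric near.
Proof. by move=> a b; rewrite /near; congr (_ == _); lia. Qed.

Definition joined (s : seq cell) : Prop := forall a b, a \in s -> b \in s ->
  exists p, [/\ path near a p, {subset p <= s} & last a p = b].

Lemma joined_cat (s1 s2 : seq cell) a1 a2 : a1 \in s1 -> a2 \in s2 -> near a1 a2 ->
  joined s1 -> joined s2 -> joined (s1 ++ s2).
Proof.
have bridge (r1 r2 : seq cell) b1 b2 a b : b1 \in r1 -> b2 \in r2 -> near b1 b2 ->
    joined r1 -> joined r2 -> a \in r1 -> b \in r2 ->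
    exists p, [/\ path near a p, forall x, x \in p -> (x \in r1) || (x \in r2) & last a p = b].
  move=> i1 i2 n12 j1 j2 ar br.
  have [p [pP ps pl]] := j1 _ _ ar i1; have [q [qP qs ql]] := j2 _ _ i2 br.
  exists (p ++ b2 :: q); split; first by rewrite cat_path pP /= pl n12.
    move=> x; rewrite mem_cat inE => /orP[/ps->//|/predU1P[->|/qs->]]; by rewrite ?i2 orbT.
  by rewrite last_cat.
move=> i1 i2 n12 j1 j2 a b; rewrite !mem_cat => /orP[a1'|a2'] /orP[b1'|b2'].
- have [p [pP ps pl]] := j1 _ _ a1' b1'; exists p; split=> // x /ps.
  by rewrite mem_cat => ->.
- have [p [pP ps pl]] := bridge _ _ _ _ _ _ i1 i2 n12 j1 j2 a1' b2'.
  by exists p; split=> // x /ps; rewrite mem_cat.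
- rewrite near_sym in n12.
  have [p [pP ps pl]] := bridge _ _ _ _ _ _ i2 i1 n12 j2 j1 a2' b1'.
  by exists p; split=> // x /ps; rewrite mem_cat orbC.
- have [p [pP ps pl]] := j2 _ _ a2' b2'; exists p; split=> // x /ps.
  by rewrite mem_cat orbC => ->.
Qed.

Lemma joined1 a : joined [:: a].
Proof. by move=> x y; rewrite !inE => /eqP-> /eqP->; exists [::]. Qed.

Lemma joined_map (g : cell -> cell) s :
  joined s -> (forall a b, near a b -> near (g a) (g b)) -> joined (map g s).
Proof.
move=> js gP _ _ /mapP[a sa ->] /mapP[b sb ->].
have [p [pP ps <-]] := js _ _ sa sb; exists (map g p); split; last by rewrite last_map.
  by rewrite path_map; apply: sub_path pP => x y; apply: gP.
by move=> _ /mapP[x /ps xs ->]; apply: map_f.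
Qed.

Lemma joined_mkseq (g : nat -> cell) n :
  (forall i, near (g i) (g i.+1)) -> joined (mkseq g n).
Proof.
move=> gP; case: n => [|n] //; elim: n => [|n IH]; first exact: joined1.
rewrite mkseqS -cats1; apply: (joined_cat _ _ (gP n)) => //; last exact: joined1.
  by apply/mapP; exists n; rewrite // mem_iota ltnSn.
by rewrite inE.
Qed.

Lemma joined_teeth (s s' : seq cell) :
  joined s -> (forall a, a \in s' -> exists2 b, b \in s & near a b) -> joined (s' ++ s).
Proof.
move=> js; elim: s' => //= a s' IH H; rewrite -cat1s.
have [|b bs nab] := H a; first by rewrite inE eqxx.
apply: joined_cat nab _ _; rewrite ?inE ?mem_cat ?bs ?orbT //; first exact: joined1.
by apply: IH => x xs; apply: H; rewrite inE xs orbT.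
Qed.

(** * Drawings and their combination along a bundle of wires *)

Section Drawings.
Variable G : sgraph.
Implicit Types (W L : {set G}) (c : G -> nat) (f : G -> seq cell).

Definition touches f (u v : G) : Prop :=
  exists a b : cell, [/\ a \in f u, b \in f v & near a b].

(* In the column [x = 0] a drawing has only cells [(0, 0, 2 * c u)], [u \in W]: they
   meet the wires of the surrounding drawing, which run at heights [2 * c u], in
   nothing but [u] itself or a neighbour of [u]. *)
Record drawing W c (w h : nat) f : Prop := Drawing {
  drawing_box : forall v (a : cell), a \in f v -> a.1.1 < w /\ a.1.2 < h;
  drawing_port : forall v (y z : nat), (0, y, z) \in f v ->
    y = 0 /\ exists u, [/\ u \in W, z = (c u).*2 & (u == v) || edge u v];
  drawing_root : forall v, v \in W -> f v != [::] -> (0, 0, (c v).*2) \in f v;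
  drawing_joined : forall v, joined (f v);
  drawing_disjoint : forall u v (a : cell), u != v -> a \in f u -> a \notin f v;
  drawing_touch : forall u v, u != v -> touches f u v -> edge u v }.

Lemma drawing_mono W c c' w w' h h' f : w <= w' -> h <= h' -> {in W, c =1 c'} ->
  drawing W c w h f -> drawing W c' w' h' f.
Proof.
move=> le_w le_h cc' d; split.
- by move=> v a /(drawing_box d)[aw ah]; split; [apply: leq_trans aw _ | apply: leq_trans ah _].
- move=> v y z /(drawing_port d)[-> [u [uW -> uv]]]; split=> //.
  by exists u; rewrite cc'.
- by move=> v vW; rewrite -cc' //; apply: (drawing_root d vW).
- exact: drawing_joined d.
- exact: drawing_disjoint d.
- exact: drawing_touch d.
Qed.

Lemma drawing_empty W c : drawing W c 0 0 (fun=> [::]).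
Proof. by split=> // u v _ [a [b []]]. Qed.

Definition tr (a : cell) : cell := (a.1.2.+1, a.1.1.+1, a.2).
Definition sh (h : nat) (a : cell) : cell := (a.1.1 + h.+1, a.1.2, a.2).

(** The wires run along the first coordinate from [0] to [h1]. Transposed and moved by one, the
    column [x = 0] of [f1] lies next to the bundle, and its ports [(0, 0, _)] meet the wires in the
    cells [(1, 0, _)]. The ports of [f2] continue the bundle just behind its end. *)
Definition comb L c (h1 : nat) f1 f2 (v : G) : seq cell :=
  (if v \in L then mkseq (fun i => (i, 0, (c v).*2)) h1.+1 else [::])
  ++ map tr (f1 v) ++ map (sh h1) (f2 v).

Lemma near_tr a b : near (tr a) (tr b) = near a b.
Proof. by rewrite /near /=; congr (_ == _); lia. Qed.

Lemma near_sh h a b : near (sh h a) (sh h b) = near a b.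
Proof. by rewrite /near /=; congr (_ == _); lia. Qed.

Lemma tr_inj : injective tr.
Proof. by move=> [[x y] z] [[x' y'] z'] [-> -> ->]. Qed.

Lemma sh_inj h : injective (sh h).
Proof. by move=> [[x y] z] [[x' y'] z'] [/addIn -> -> ->]. Qed.

Lemma mem_comb L c h1 f1 f2 v (a : cell) : reflect
  [\/ v \in L /\ exists2 i, i <= h1 & a = (i, 0, (c v).*2),
      exists2 b : cell, b \in f1 v & a = tr b
    | exists2 b : cell, b \in f2 v & a = sh h1 b] (a \in comb L c h1 f1 f2 v).
Proof.
apply: (iffP idP); rewrite !mem_cat.
  case/or3P=> [|/mapP[b bf ->]|/mapP[b bf ->]].
  - case: ifP => // vL /mapP[i]; rewrite mem_iota => /andP[_ lt_i] ->.
    by constructor 1; split=> //; exists i.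
  - by constructor 2; exists b.
  - by constructor 3; exists b.
case=> [[-> [i le_i ->]]|[b bf ->]|[b bf ->]]; apply/or3P.
- by constructor 1; apply/mapP; exists i; rewrite // mem_iota.
- by constructor 2; apply: map_f.
- by constructor 3; apply: map_f.
Qed.

Lemma comb_eq0 L c h1 f1 f2 v :
  (comb L c h1 f1 f2 v == [::]) = [&& v \notin L, f1 v == [::] & f2 v == [::]].
Proof.
by rewrite -!size_eq0 !size_cat !size_map; case: ifP => _; rewrite ?size_mkseq !addn_eq0.
Qed.

Lemma touches_comb1 L c h1 f1 f2 u v : touches f1 u v -> touches (comb L c h1 f1 f2) u v.
Proof.
move=> [a [b [af bf nab]]]; exists (tr a), (tr b); rewrite near_tr; split=> //;
  by apply/mem_comb; constructor 2; eexists; eauto.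
Qed.

Lemma touches_comb2 L c h1 f1 f2 u v : touches f2 u v -> touches (comb L c h1 f1 f2) u v.
Proof.
move=> [a [b [af bf nab]]]; exists (sh h1 a), (sh h1 b); rewrite near_sh; split=> //;
  by apply/mem_comb; constructor 3; eexists; eauto.
Qed.

Lemma touches_comb_port L c h1 f1 f2 u v : 0 < h1 -> u \in L ->
  (0, 0, (c u).*2) \in f1 v -> touches (comb L c h1 f1 f2) v u.
Proof.
move=> h1_gt0 uL pf; exists (tr (0, 0, (c u).*2)), (1, 0, (c u).*2); split.
- by apply/mem_comb; constructor 2; eexists; eauto.
- by apply/mem_comb; constructor 1; split=> //; exists 1.
- by rewrite /near /=; lia.
Qed.

(** The bundle meets [f1] and [f2] only at ports, where injectivity on [X] identifies the wire with
    the vertex given by [drawing_port]. A vertex drawn in both [f1] and [f2] has a wire, which joins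
    the two roots. *)
Lemma drawing_comb L W1 W2 c w1 h1 w2 h2 f1 f2 (X : {set G}) :
  {in X &, injective c} -> L \subset X -> W1 \subset X -> W2 \subset X ->
  drawing W1 c w1 h1 f1 -> drawing W2 c w2 h2 f2 ->
  (forall v, v \in L -> f1 v != [::] -> v \in W1) ->
  (forall v, v \in L -> f2 v != [::] -> v \in W2) ->
  (forall v, f1 v != [::] -> f2 v != [::] -> v \in L) ->
  drawing L c (1 + h1 + w2) (maxn w1.+1 h2) (comb L c h1 f1 f2).
Proof.
move=> cinj /subsetP LX /subsetP W1X /subsetP W2X d1 d2 L1 L2 L12.
have port1 u v i (y z x : nat) : u \in L -> (x, y, z) \in f1 v ->
    near (i, 0, (c u).*2) (tr (x, y, z)) -> (u == v) || edge u v.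
  rewrite /near /= => uL vf n1.
  have x0 : x = 0 by lia.
  subst x; have [y0 [u' [u'W zE]]] := drawing_port d1 vf.
  by have <- : u' = u; first by apply: cinj; [exact: W1X | exact: LX | lia].
have port2 u v i (y z x : nat) : i <= h1 -> u \in L -> (x, y, z) \in f2 v ->
    near (i, 0, (c u).*2) (sh h1 (x, y, z)) -> (u == v) || edge u v.
  rewrite /near /= => le_i uL vf n1.
  have x0 : x = 0 by lia.
  subst x; have [y0 [u' [u'W zE]]] := drawing_port d2 vf.
  by have <- : u' = u; first by apply: cinj; [exact: W2X | exact: LX | lia].
(* Only cells in the column [x = 0] of [f2] could be close enough, but there the second coordinate
   is 0, while it is positive on transposed cells. *)
have far u v (a b : cell) : a \in f1 u -> b \in f2 v -> near (tr a) (sh h1 b) = false.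
  case: a b => [[x y] z] [[x' y'] z'] af bf; apply/negP; rewrite /near /= => n1.
  have /= [_ yh] := drawing_box d1 af.
  have x0 : x' = 0 by lia.
  by subst x'; have [y0 _] := drawing_port d2 bf; lia.
split.
- move=> v a /mem_comb[[_ [i le_i ->]]|[b bf ->]|[b bf ->]] /=; first by lia.
    by have := drawing_box d1 bf; lia.
  by have := drawing_box d2 bf; lia.
- move=> v y z /mem_comb[[vL [i le_i [_ -> ->]]]|[b bf []]|[b bf []]]; try lia.
  by split=> //; exists v; rewrite vL eqxx.
- by move=> v vL _; apply/mem_comb; constructor 1; split=> //; exists 0.
- move=> v; rewrite /comb.
  have j1 : joined (map tr (f1 v)).
    by apply: (joined_map (@drawing_joined _ _ _ _ _ d1 v)) => a b; rewrite near_tr.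
  have j2 : joined (map (sh h1) (f2 v)).
    by apply: (joined_map (@drawing_joined _ _ _ _ _ d2 v)) => a b; rewrite near_sh.
  case: ifP => vL; last first.
    case: (eqVneq (f1 v) [::]) => [->|f10] //=.
    case: (eqVneq (f2 v) [::]) => [->|f20] //=; first by rewrite cats0.
    by rewrite L12 in vL.
  have jl : joined (mkseq (fun i => (i, 0, (c v).*2)) h1.+1).
    by apply: joined_mkseq => i; rewrite /near /=; lia.
  rewrite catA; case: (eqVneq (f2 v) [::]) => [->|f20].
    rewrite cats0; case: (eqVneq (f1 v) [::]) => [->|f10]; first by rewrite cats0.
    have r1 := drawing_root d1 (L1 v vL f10) f10.
    have h1_gt0 : 0 < h1 := proj2 (drawing_box d1 r1).
    apply: (joined_cat (a1 := (1, 0, (c v).*2)) _ (map_f tr r1)) => //.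
      by apply/mapP; exists 1; rewrite // mem_iota.
    by rewrite /near /=; lia.
  have r2 := drawing_root d2 (L2 v vL f20) f20.
  apply: (joined_cat (a1 := (h1, 0, (c v).*2)) _ (map_f (sh h1) r2)) => //.
  + by rewrite mem_cat; apply/orP; left; apply/mapP; exists h1; rewrite // mem_iota ltnSn.
  + by rewrite /near /=; lia.
  case: (eqVneq (f1 v) [::]) => [->|f10]; first by rewrite cats0.
  have r1 := drawing_root d1 (L1 v vL f10) f10.
  have h1_gt0 : 0 < h1 := proj2 (drawing_box d1 r1).
  apply: (joined_cat (a1 := (1, 0, (c v).*2)) _ (map_f tr r1)) => //.
    by apply/mapP; exists 1; rewrite // mem_iota.
  by rewrite /near /=; lia.
- move=> u v a uv /mem_comb aE; apply/negP => /mem_comb bE.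
  case: aE bE => [[uL [i le_i ->]]|[b bf ->]|[b bf ->]];
    case=> [[vL [j le_j]]|[b' bf']|[b' bf']].
  + by case=> _ E; case/eqP: uv; apply: cinj; [exact: LX | exact: LX | lia].
  + by case; lia.
  + by case; lia.
  + by case; lia.
  + by move/tr_inj => E; subst b'; have := drawing_disjoint d1 uv bf; rewrite bf'.
  + by case; have := drawing_box d1 bf; lia.
  + by case; lia.
  + by case; have := drawing_box d1 bf'; lia.
  + by move/sh_inj => E; subst b'; have := drawing_disjoint d2 uv bf; rewrite bf'.
- move=> u v uv [a [b [/mem_comb aE /mem_comb bE]]].
  have eq_edge (x y : G) : x != y -> (x == y) || edge x y -> edge x y by case: eqP.
  have vu : v != u by rewrite eq_sym.
  case: aE bE => [[uL [i le_i ->]]|[[[x y] z] af ->]|[[[x y] z] af ->]];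
    case=> [[vL [j le_j ->]]|[[[x' y'] z'] bf ->]|[[[x' y'] z'] bf ->]].
  (* Wires run at even heights, so near cells on two wires have the same height and hence the same
     colour. *)
  + by rewrite /near /= => n1; case/eqP: uv; apply: cinj; [exact: LX | exact: LX | lia].
  + by move/(port1 _ _ _ _ _ _ uL bf)/(eq_edge _ _ uv).
  + by move/(port2 _ _ _ _ _ _ le_i uL bf)/(eq_edge _ _ uv).
  + by rewrite near_sym edge_sym => /(port1 _ _ _ _ _ _ vL af)/(eq_edge _ _ vu).
  + by rewrite near_tr => nab; apply: (drawing_touch d1 uv); do 2!eexists; split; eauto.
  + by rewrite (far _ _ _ _ af bf).
  + by rewrite near_sym edge_sym => /(port2 _ _ _ _ _ _ le_j vL af)/(eq_edge _ _ vu).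
  + by rewrite near_sym (far _ _ _ _ bf af).
  + by rewrite near_sh => nab; apply: (drawing_touch d2 uv); do 2!eexists; split; eauto.
Qed.

(** The spine proper stands in the column [(1, 0, _)], as the column [x = 0] may hold only ports.
    The tooth at the height of [x] itself is the cell demanded by [drawing_root]. *)
Definition spine W c (x : G) (n : nat) (v : G) : seq cell :=
  if v == x then [seq (0, 0, (c u).*2) | u <- enum W & (u == x) || edge u x]
                 ++ mkseq (fun z => (1, 0, z)) n
  else [::].

Lemma drawing_spine W c x n : x \in W -> (forall u, u \in W -> (c u).*2 < n) ->
  drawing W c 2 1 (spine W c x n).
Proof.
move=> xW cW; split.
- move=> v a; rewrite /spine; case: eqP => // _; rewrite mem_cat.
  by case/orP=> /mapP[y _ ->].
- move=> v y z; rewrite /spine; case: eqP => // ->; rewrite mem_cat.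
  case/orP=> /mapP[u]; rewrite 1?mem_filter => uP; last by case.
  case=> -> ->; split=> //; exists u.
  by move: uP; rewrite mem_enum => /andP[-> ->].
- move=> v vW; rewrite /spine; case: (v =P x) => [->|_]; rewrite ?eqxx // => _; rewrite mem_cat.
  by apply/orP; left; apply/mapP; exists x; rewrite // mem_filter eqxx mem_enum.
- move=> v; rewrite /spine; case: eqP => // _; apply: joined_teeth.
    by apply: joined_mkseq => i; rewrite /near /=; lia.
  move=> _ /mapP[u uP ->]; exists (1, 0, (c u).*2); last by rewrite /near /=; lia.
  apply/mapP; exists (c u).*2; rewrite // mem_iota add0n cW //.
  by move: uP; rewrite mem_filter mem_enum => /andP[].
- move=> u v a uv; rewrite /spine; case: (u =P x) => // ux; case: (v =P x) => // vx.
  by rewrite ux vx eqxx in uv.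
- move=> u v uv [a [b []]]; rewrite /spine; case: (u =P x) => // ux; case: (v =P x) => // vx.
  by rewrite ux vx eqxx in uv.
Qed.

End Drawings.

(** * Colourings, rows of drawings, and the drawing of a piece from its parts *)

Lemma extend_coloring (V : finType) (W X : {set V}) (c : V -> nat) (Q : nat) :
  W \subset X -> #|X| <= Q -> {in W &, injective c} -> (forall u, u \in W -> c u < Q) ->
  exists c' : V -> nat, [/\ {in W, c' =1 c}, {in X &, injective c'}
    & forall u, u \in X -> c' u < Q].
Proof.
move En: #|X :\: W| => n; elim: n X En => [|n IH] X En sWX le_XQ cinj cQ.
  move/eqP: En; rewrite cards_eq0 setD_eq0 => sXW.
  have -> : X = W by apply/eqP; rewrite eqEsubset sXW.
  by exists c.
have /card_gt0P[x] : 0 < #|X :\: W| by rewrite En.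
rewrite inE => /andP[xW xX].
have cX : #|X :\ x| < #|X| by rewrite (cardsD1 x X) xX.
have [|||c' [c'W c'inj c'Q]] := IH (X :\ x) _ _ _ cinj cQ.
- by rewrite setDDl setUC -setDDl; move: En; rewrite (cardsD1 x) !inE xX xW => -[].
- by rewrite subsetD1 sWX.
- by apply: leq_trans (ltnW cX) le_XQ.
(* The other elements of [X] use fewer than [Q] colours, so one is free. *)
have /hasP[k] : has (fun k => k \notin [seq c' u | u in X :\ x]) (iota 0 Q).
  apply: contraT; rewrite has_predC negbK => /allP sub.
  have := uniq_leq_size (iota_uniq 0 Q) sub; rewrite size_iota size_map -cardE.
  by rewrite leqNgt (leq_trans cX).
rewrite mem_iota => /= kQ /negP kc.
have fresh u : u \in X -> u != x -> c' u != k.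
  by move=> uX ux; apply/eqP => E; apply: kc; rewrite -E; apply: image_f; rewrite !inE ux.
exists (fun u => if u == x then k else c' u); split.
- by move=> u uW; case: eqP => [E|_]; [rewrite -E uW in xW | apply: c'W].
- move=> u v uX vX; case: (eqVneq u x) => [->|ux]; case: (eqVneq v x) => [->|vx] //.
  + by move/esym/eqP; rewrite (negPf (fresh _ vX vx)).
  + by move/eqP; rewrite (negPf (fresh _ uX ux)).
  + by apply: c'inj; rewrite !inE ?ux ?vx.
- by move=> u uX; case: (eqVneq u x) => // ux; apply: c'Q; rewrite !inE ux.
Qed.

Lemma size_comb (G : sgraph) (L : {set G}) c h f1 f2 :
  \sum_v size (comb L c h f1 f2 v) =
  #|L| * h.+1 + \sum_v size (f1 v) + \sum_v size (f2 v).
Proof.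
under eq_bigr => v _ do rewrite /comb !size_cat !size_map addnA.
rewrite !big_split /= -sum_nat_const [X in _ = X + _ + _]big_mkcond /=.
by congr (_ + _ + _); apply: eq_bigr => v _; case: ifP; rewrite ?size_mkseq.
Qed.

Section Rows.
Variables (G : sgraph) (L : {set G}) (c : G -> nat).
Variables (I : eqType) (h : I -> nat) (F : I -> G -> seq cell).

Definition row (s : seq I) : G -> seq cell :=
  foldr (fun i f => comb L c (h i) (F i) f) (fun=> [::]) s.

Lemma row_neq0 s v : row s v != [::] -> v \in L \/ exists2 i, i \in s & F i v != [::].
Proof.
elim: s => //= i s IH; rewrite comb_eq0 !negb_and negbK.
case/or3P=> [->|Fi|/IH[->|[j js Fj]]]; [by left|right|by left|right].
  by exists i; rewrite ?inE ?eqxx.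
by exists j; rewrite ?inE ?js ?orbT.
Qed.

Lemma row_item_neq0 s i v : i \in s -> F i v != [::] -> row s v != [::].
Proof.
elim: s => //= j s IH; rewrite inE comb_eq0 !negb_and => /predU1P[<- ->|is_ Fi].
  by rewrite orbT.
by rewrite IH // !orbT.
Qed.

Lemma touches_row s i u v : i \in s -> touches (F i) u v -> touches (row s) u v.
Proof.
elim: s => //= j s IH; rewrite inE => /predU1P[<-|is_] tF; first exact: touches_comb1.
by apply: touches_comb2; apply: IH.
Qed.

Lemma touches_row_port s i u v : i \in s -> 0 < h i -> u \in L ->
  (0, 0, (c u).*2) \in F i v -> touches (row s) v u.
Proof.
elim: s => //= j s IH; rewrite inE => /predU1P[<-|is_] h0 uL pF.
  exact: touches_comb_port.
by apply: touches_comb2; apply: IH.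
Qed.

Lemma size_row s : \sum_v size (row s v) =
  #|L| * (\sum_(i <- s) (h i).+1) + \sum_(i <- s) \sum_v size (F i v).
Proof.
elim: s => [|i s IH]; first by rewrite !big_nil muln0 big1.
by rewrite /= size_comb IH !big_cons mulnDr; lia.
Qed.

(** A vertex drawn in two items has to be in [L], for only the bundle connects different items. *)
Lemma drawing_row (W : I -> {set G}) (w : I -> nat) s : {in L &, injective c} ->
  (forall i, i \in s -> [/\ drawing (W i) c (w i) (h i) (F i), W i \subset L
    & forall v, v \in L -> F i v != [::] -> v \in W i]) ->
  pairwise [rel i j | [forall v, (F i v != [::]) && (F j v != [::]) ==> (v \in L)]] s ->
  drawing L c (\sum_(i <- s) (h i).+1) (\max_(i <- s) (w i).+1) (row s).
Proof.
move=> cinj; elim: s => [|i s IH] ds; first by rewrite !big_nil => _; apply: drawing_empty.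
rewrite pairwise_cons => /andP[/allP pi ps]; rewrite !big_cons.
have [di WiL Li] := ds i (mem_head _ _).
have dr : drawing L c (\sum_(j <- s) (h j).+1) (\max_(j <- s) (w j).+1) (row s).
  by apply: IH => // j js; apply: ds; rewrite inE js orbT.
apply: drawing_comb cinj _ WiL _ di dr Li _ _ => // v Fi.
case/row_neq0=> // -[j js Fj].
by have /forallP/(_ v) := pi j js; rewrite Fi Fj.
Qed.

End Rows.

Section Nodes.
Variables (G : sgraph) (bag : G -> {set G}) (Q : nat).
Hypothesis mem_bag : forall x, x \in bag x.
Local Notation occ := (occ bag).
Local Notation boundary := (boundary bag).

(** The colouring is given in advance because the surrounding drawing has already fixed the heights
    of its wires. An edge [x y] is realised in the piece holding the node [x] whose bag contains
    [y]. *)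
Definition drawable (P : {set G}) (w h n : nat) : Prop :=
  forall c : G -> nat, {in boundary P &, injective c} ->
    (forall u, u \in boundary P -> c u < Q) ->
  exists f, [/\ drawing (boundary P) c w h f,
    forall v, f v != [::] -> v \in occ (enum P),
    forall x, x \in P -> f x != [::],
    forall x y, x \in P -> y \in bag x -> edge x y -> touches f x y
  & \sum_v size (f v) <= n].

Lemma boundary_sub P : boundary P \subset occ (enum P).
Proof. exact: subsetIl. Qed.

Lemma drawable0 : drawable set0 0 0 0.
Proof.
move=> c _ _; exists (fun=> [::]); split; rewrite ?big1 //; first exact: drawing_empty.
  by move=> x; rewrite inE.
by move=> x y; rewrite inE.
Qed.

(** The bundle carries [X], the boundary of [P] together with the bags of the removed nodes. The
    boundary of each part lies in [X], so the given colouring, extended to [X], also serves for the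
    parts. *)
Lemma drawable_node (P : {set G}) (own : seq G) (Ps : seq {set G})
    (w h n : {set G} -> nat) :
  {subset own <= P} ->
  (forall A, A \in Ps -> A \subset P /\ forall x, x \in own -> x \notin A) ->
  (forall x, x \in P -> x \in own \/ exists2 A, A \in Ps & x \in A) ->
  pairwise [rel A1 A2 : {set G} | occ (enum A1) :&: occ (enum A2) \subset occ own] Ps ->
  #|boundary P :|: occ own| <= Q ->
  (forall A, A \in Ps -> drawable A (w A) (h A) (n A)) ->
  drawable P (1 + (size own * 2 + \sum_(A <- Ps) (h A).+1))
    (maxn 3 (\max_(A <- Ps) (w A).+1))
    (Q * (1 + (size own * 5 + \sum_(A <- Ps) (h A).+1)) + \sum_(A <- Ps) n A).
Proof.
move=> ownP PsP Pcover sep XQ dPs c cinj cQ.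
pose X := boundary P :|: occ own.
have bX : boundary P \subset X by apply: subsetUl.
have [c' [c'c c'inj c'Q]] := extend_coloring bX XQ cinj cQ.
have occ_enumP (A : {set G}) u x : x \in A -> u \in bag x -> u \in occ (enum A).
  by move=> xA ux; apply/occP; exists x; rewrite ?mem_enum.
have sub_occ (A B : {set G}) : A \subset B -> occ (enum A) \subset occ (enum B).
  by move=> /subsetP AB; apply: occ_sub => x; rewrite !mem_enum; apply: AB.
(* An element of [boundary A] also occurs at some node [y] outside [A], which is outside [P],
   removed, or in another part. *)
have bAX A : A \in Ps -> boundary A \subset X.
  move=> APs; have [AP Aown] := PsP A APs.
  apply/subsetP => u; rewrite inE => /andP[uA /occP[y]].
  rewrite mem_enum inE => yA uy; rewrite inE.
  case: (boolP (y \in P)) => yP; last first.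
    by rewrite inE (subsetP (sub_occ _ _ AP)) // (occ_enumP _ _ y) // inE.
  case: (Pcover y yP) => [yown|[A' A'Ps yA']].
    by apply/orP; right; apply/occP; exists y.
  have uA' : u \in occ (enum A') by apply: occ_enumP uy.
  have iA : index A Ps < size Ps by rewrite index_mem.
  have iA' : index A' Ps < size Ps by rewrite index_mem.
  apply/orP; right; case: (ltngtP (index A Ps) (index A' Ps)) => lt_i.
  - have /(pairwiseP set0)/(_ _ _ iA iA' lt_i) := sep.
    by rewrite /= !nth_index // => /subsetP; apply; rewrite inE uA.
  - have /(pairwiseP set0)/(_ _ _ iA' iA lt_i) := sep.
    by rewrite /= !nth_index // => /subsetP; apply; rewrite inE uA'.
  - move: yA; suff -> : A = A' by rewrite yA'.
    by rewrite -(nth_index set0 APs) lt_i nth_index.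
have /fin_all_exists[f fP] (A : {set G}) : exists f, A \in Ps ->
  [/\ drawing (boundary A) c' (w A) (h A) f,
    forall v, f v != [::] -> v \in occ (enum A),
    forall x, x \in A -> f x != [::],
    forall x y, x \in A -> y \in bag x -> edge x y -> touches f x y
  & \sum_v size (f v) <= n A].
  case: (boolP (A \in Ps)) => [APs|_]; last by exists (fun=> [::]).
  have /subsetP AX := bAX A APs.
  have [||f fP] := dPs A APs c'; last by exists f.
    by move=> u v uA vA; apply: c'inj; apply: AX.
  by move=> u uA; apply: c'Q; apply: AX.
pose F (i : G + {set G}) := match i with inl x => spine X c' x Q.*2 | inr A => f A end.
pose hi (i : G + {set G}) := match i with inl _ => 1 | inr A => h A end.
pose wi (i : G + {set G}) := match i with inl _ => 2 | inr A => w A end.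
pose Wi (i : G + {set G}) := match i with inl _ => X | inr A => boundary A end.
pose s : seq (G + {set G}) := map inl own ++ map inr Ps.
have ownX x : x \in own -> x \in X.
  by move=> xo; rewrite inE; apply/orP; right; apply/occP; exists x.
have spine0 x v : spine X c' x Q.*2 v != [::] -> v = x.
  by rewrite /spine; case: (v =P x).
have sE i : i \in s -> (exists2 x, x \in own & i = inl x) \/ (exists2 A, A \in Ps & i = inr A).
  by rewrite mem_cat => /orP[] /mapP[y ys ->]; [left|right]; exists y.
have dr : drawing X c' (\sum_(i <- s) (hi i).+1) (\max_(i <- s) (wi i).+1) (row X c' hi F s).
  apply: (drawing_row (W := Wi)) => //.
    move=> i /sE[[x xo ->]|[A APs ->]] /=.
      split=> //; apply: drawing_spine; first exact: ownX.
      by move=> u uX; rewrite ltn_double c'Q.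
    have [fA1 fA2 _ _ _] := fP A APs; split=> //; first exact: bAX.
    move=> v vX /fA2 vA; rewrite inE vA /=; have [AP Aown] := PsP A APs.
    move: vX; rewrite inE => /orP[|/occP[y yo vy]].
      by rewrite inE => /andP[_]; apply: (subsetP (sub_occ _ _ _)); rewrite setCS.
    by apply: occ_enumP vy; rewrite inE Aown.
  rewrite /s pairwise_cat !pairwise_map allrel_mapl allrel_mapr; apply/and3P; split.
  - apply/allrelP => x A xo _; apply/forallP => v; apply/implyP => /andP[/spine0-> _].
    exact: ownX.
  - apply: (@sub_in_pairwise _ (mem own) (fun _ _ => true)); last 2 first.
    + exact/allP.
    + by elim: (own) => //= x l ->; rewrite andbT; elim: l.
    move=> x y xo _ _; apply/forallP => v; apply/implyP => /andP[/spine0-> _].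
    exact: ownX.
  - apply: (@sub_in_pairwise _ (mem Ps)) sep; last exact/allP.
    move=> A A' APs A'Ps /= /subsetP sAA; apply/forallP => v; apply/implyP => /andP[vA vA'].
    have [_ /(_ v vA) {}vA _ _ _] := fP A APs; have [_ /(_ v vA') {}vA' _ _ _] := fP A' A'Ps.
    by rewrite inE; apply/orP; right; apply: sAA; rewrite inE vA.
have sum_s (g : G + {set G} -> nat) : \sum_(i <- s) g i =
    \sum_(x <- own) g (inl x) + \sum_(A <- Ps) g (inr A).
  by rewrite big_cat !big_map.
have hE : \sum_(i <- s) (hi i).+1 = size own * 2 + \sum_(A <- Ps) (h A).+1.
  by rewrite sum_s /= big_const_seq count_predT iter_addn_0 mulnC.
have wE : maxn 1 (\max_(i <- s) (wi i).+1) <= maxn 3 (\max_(A <- Ps) (w A).+1).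
  rewrite big_cat !big_map /= geq_max leq_max /=.
  rewrite geq_max leq_maxr andbT; apply: leq_trans (leq_maxl _ _).
  by apply/bigmax_leqP_seq.
pose R := row X c' hi F s.
(* The row has ports for all of [X]. In front of it comes a stub with one cell for each wire of
   [boundary P], so that no other wire reaches the column [x = 0]. *)
have dN : drawing (boundary P) c' (1 + 0 + \sum_(i <- s) (hi i).+1)
    (maxn 1 (\max_(i <- s) (wi i).+1)) (comb (boundary P) c' 0 (fun=> [::]) R).
  apply: (drawing_comb c'inj bX (sub0set X) (subxx X) (drawing_empty set0 c') dr) => //.
  by move=> v /(subsetP bX).
have occXP u : u \in X -> u \in occ (enum P).
  rewrite in_setU => /orP[/(subsetP (boundary_sub P)) //|/occP[x xo ux]].
  exact: occ_enumP _ _ _ (ownP x xo) ux.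
have inl_s x : x \in own -> inl x \in s by move=> xo; rewrite mem_cat map_f.
have inr_s A : A \in Ps -> inr A \in s by move=> xo; rewrite mem_cat map_f ?orbT.
have comb0 v : R v != [::] -> comb (boundary P) c' 0 (fun=> [::]) R v != [::].
  by move=> Rv; rewrite comb_eq0 !negb_and Rv !orbT.
have tooth x y : y \in X -> (y == x) || edge y x -> (0, 0, (c' y).*2) \in spine X c' x Q.*2 x.
  move=> yX yx; rewrite /spine eqxx mem_cat; apply/orP; left; apply/mapP.
  by exists y; rewrite // mem_filter yx mem_enum.
exists (comb (boundary P) c' 0 (fun=> [::]) R); split.
- by apply: drawing_mono dN; rewrite ?hE.
- move=> v; rewrite comb_eq0 !negb_and negbK => /or3P[/(subsetP bX)/occXP //|//|].
  case/row_neq0=> [/occXP //|[i /sE[[x xo ->]|[A APs ->]] /=]].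
    by move/spine0->; apply: occ_enumP _ _ _ (ownP x xo) (mem_bag x).
  have [_ fA _ _ _] := fP A APs; have [AP _] := PsP A APs.
  by move/fA; apply: (subsetP (sub_occ _ _ AP)).
- move=> x /Pcover[xo|[A APs xA]]; apply: comb0.
    apply: row_item_neq0 (inl_s x xo) _ => /=; apply/eqP => E.
    by have := tooth x x (ownX x xo); rewrite eqxx E => /(_ isT).
  by have [_ _ fA _ _] := fP A APs; apply: row_item_neq0 (inr_s A APs) (fA x xA).
- move=> x y /Pcover[xo|[A APs xA]] yx exy; apply: touches_comb2.
    have yX : y \in X by rewrite inE; apply/orP; right; apply/occP; exists x.
    apply: (touches_row_port (inl_s x xo) _ yX) => //=.
    by apply: (tooth x y yX); rewrite edge_sym exy orbT.
  have [_ _ _ fA _] := fP A APs; apply: touches_row (inr_s A APs) _.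
  exact: fA xA yx exy.
(* A removed node costs [5 Q]: [2 Q] for its segment of the bundle, [2 Q] for the column of its
   spine and [Q] for the teeth. The summand 1 accounts for the stub. *)
- rewrite size_comb size_row hE big1 // addn0 muln1 sum_s /=.
  have bQ : #|boundary P| <= Q by apply: leq_trans (subset_leq_card bX) XQ.
  have spineQ x : \sum_v size (spine X c' x Q.*2 v) <= Q * 3.
    rewrite (bigD1 x) //= big1 ?addn0; last by move=> v /negPf vx; rewrite /spine vx.
    rewrite /spine eqxx size_cat size_map size_mkseq.
    have -> : Q * 3 = Q + Q.*2 by lia.
    by rewrite leq_add2r size_filter (leq_trans (count_size _ _)) // -cardE.
  have spinesQ : \sum_(x <- own) \sum_v size (spine X c' x Q.*2 v) <= size own * (Q * 3).
    have -> : size own * (Q * 3) = \sum_(x <- own) Q * 3.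
      by rewrite big_const_seq count_predT iter_addn_0 mulnC.
    exact: leq_sum.
  have szA : \sum_(A <- Ps) \sum_v size (f A v) <= \sum_(A <- Ps) n A.
    by rewrite !big_seq; apply: leq_sum => A /fP[].
  have XQ' := leq_mul (XQ : #|X| <= Q) (leqnn (size own * 2 + \sum_(A <- Ps) (h A).+1)).
  rewrite !mulnDr; move: XQ'; rewrite !mulnDr.
  by move: (\sum_(i <- own) _) (\sum_(i <- Ps) \sum_v _) spinesQ szA; lia.
Qed.

End Nodes.

(** * The recursion for side lengths and size *)

Fixpoint width_const (k : nat) : nat := if k is k'.+1 then 25 + 5 * width_const k' else 0.

Lemma width_const_le k : width_const k + 7 <= 7 * 5 ^ k.
Proof. by elim: k => //= k IH; rewrite expnS; lia. Qed.

(* The first two clauses bound the side lengths by the lower envelope of the lines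
   [width_const k + 50 m / 2 ^ k], a sublinear function of [m].  The third one is
   [n <= 504 Q m] with a slack, decreasing in [m], that absorbs the sides of the
   boxes at all levels of the recursion. *)
Definition small_drawing (Q m w h n : nat) : Prop :=
  [/\ forall k, w * 2 ^ k <= width_const k * 2 ^ k + 50 * m,
      forall k, h * 2 ^ k.+1 <= (3 + width_const k) * 2 ^ k.+1 + 50 * m
    & forall k r, r <= 4 -> m < 2 ^ (4 * k + r) ->
        2 ^ k * n + Q * 63 * (8 - r) * m <= Q * 63 * 8 * 2 ^ k * m].

Lemma small_drawing0 Q : small_drawing Q 0 0 0 0.
Proof. by split=> *; rewrite ?muln0. Qed.

Lemma small_drawing_node (T : eqType) (s : seq T) (m' w h n : T -> nat) (Q m p : nat) :
  0 < m -> p <= 2 -> size s <= 5 -> \sum_(i <- s) m' i <= m ->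
  (forall i, i \in s -> (m' i).*2 <= m) ->
  (forall i, i \in s -> small_drawing Q (m' i) (w i) (h i) (n i)) ->
  small_drawing Q m (1 + (p * 2 + \sum_(i <- s) (h i).+1))
    (maxn 3 (\max_(i <- s) (w i).+1))
    (Q * (1 + (p * 5 + \sum_(i <- s) (h i).+1)) + \sum_(i <- s) n i).
Proof.
move=> m0 p2 s5 sm half sd; set H := \sum_(i <- s) (h i).+1.
have HK k : H * 2 ^ k.+1 <= 5 * (4 + width_const k) * 2 ^ k.+1 + 50 * m.
  have : H * 2 ^ k.+1 <= \sum_(i <- s) ((4 + width_const k) * 2 ^ k.+1 + 50 * m' i).
    rewrite /H big_distrl /= !big_seq; apply: leq_sum => i /sd[_ /(_ k) + _].
    by rewrite mulSn !mulnDl; lia.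
  move/leq_trans; apply; rewrite big_split /= big_const_seq count_predT iter_addn_0.
  have -> : \sum_(i <- s) 50 * m' i = 50 * \sum_(i <- s) m' i by rewrite big_distrr.
  by rewrite mulnC -[5 * _ * _]mulnA leq_add ?leq_mul.
(* At most two removed nodes give [1 + 2 * 2], and five parts give [5 * (4 + width_const k)]; hence
   the recursion of [width_const]. For [k = 0] the bound is [25 + 25 m <= 50 m], as [m] is
   positive. *)
have wK k : (1 + (p * 2 + H)) * 2 ^ k <= width_const k * 2 ^ k + 50 * m.
  case: k => [|k].
    by have := HK 0; rewrite expn1 /=; lia.
  have := HK k; have K0 : 0 < 2 ^ k.+1 by rewrite expn_gt0.
  have -> : width_const k.+1 = 25 + 5 * width_const k by [].
  by move: (2 ^ k.+1) K0 => K K0; nia.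
split=> //.
  move=> k; set R := _ * _ + _.
  have R3 : 3 * 2 ^ k.+1 <= R by rewrite /R mulnDl -addnA leq_addr.
  have Rm x y : x * 2 ^ k.+1 <= R -> y * 2 ^ k.+1 <= R -> maxn x y * 2 ^ k.+1 <= R.
    by move=> xR yR; rewrite maxnMl geq_max xR.
  apply: (Rm) => //; rewrite big_seq; apply: (big_ind (fun x => x * 2 ^ k.+1 <= R)).
  - by [].
  - exact: Rm.
  (* A part has at most half of the nodes, which turns the denominator [2 ^ k] into [2 ^ k.+1]. *)
  move=> i is_; have [/(_ k) wi _ _] := sd i is_; have := half i is_.
  have K0 : 0 < 2 ^ k by rewrite expn_gt0.
  by rewrite /R expnS; move: (2 ^ k) K0 wi => K K0; nia.
set N := Q * _ + _.
(* If [m] is at least [2 ^ (4 * k + r)], the parts are still below this threshold and have the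
   larger slack with [8 - r]. The difference, [63 Q m / 2 ^ k], pays for the bundle and the spines
   of the node. *)
have step k r : r < 4 ->
    (m < 2 ^ (4 * k + r) -> 2 ^ k * N + Q * 63 * (8 - r) * m <= Q * 63 * 8 * 2 ^ k * m) ->
    m < 2 ^ (4 * k + r.+1) ->
    2 ^ k * N + Q * 63 * (8 - r.+1) * m <= Q * 63 * 8 * 2 ^ k * m.
  move=> r4 IH lt_m; case: (ltnP m (2 ^ (4 * k + r))) => [/IH|le_m].
    by apply: leq_trans; rewrite leq_add2l leq_mul // leq_mul //; lia.
  have sumN : 2 ^ k * (\sum_(i <- s) n i) + Q * 63 * (8 - r) * (\sum_(i <- s) m' i)
              <= Q * 63 * 8 * 2 ^ k * (\sum_(i <- s) m' i).
    rewrite !big_distrr -big_split /= !big_seq; apply: leq_sum => i is_.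
    have [_ _ /(_ k r (ltnW r4))] := sd i is_; apply.
    have := half i is_; rewrite -ltn_double; move: lt_m; rewrite addnS expnS.
    by lia.
  (* The 6 covers the spines. By [wK] and [width_const_le] the left side is at most
     [7 * 10 ^ k + 50 m], and [10 ^ k <= 16 ^ k <= m]. *)
  have wide : 2 ^ k * (1 + (p * 2 + H) + 6) <= 63 * m.
    have := wK k; have := width_const_le k.
    have : 5 ^ k * 2 ^ k <= m.
      rewrite -expnMn; apply: leq_trans le_m; rewrite expnD expnM.
      apply: leq_trans (leq_pmulr _ _); rewrite ?expn_gt0 //.
      by case: (k) => // k'; rewrite leq_exp2r.
    have K0 : 0 < 2 ^ k by rewrite expn_gt0.
    by move: (2 ^ k) (5 ^ k) K0 => K F K0; nia.
  have K0 : 0 < 2 ^ k by rewrite expn_gt0.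
  have {}sumN : 2 ^ k * (\sum_(i <- s) n i) + Q * 63 * (8 - r) * m <= Q * 63 * 8 * 2 ^ k * m.
    have [t mE] : exists t, m = \sum_(i <- s) m' i + t.
      by exists (m - \sum_(i <- s) m' i); rewrite subnKC.
    have tE : Q * 63 * (8 - r) * t <= Q * 63 * 8 * 2 ^ k * t.
      rewrite leq_mul // -[X in _ <= X]mulnA leq_mul //.
      by apply: leq_trans (leq_subr _ _) (leq_pmulr _ _).
    by rewrite mE !(mulnDr _ _ t); lia.
  have wideQ : 2 ^ k * (Q * (1 + (p * 5 + H))) <= Q * 63 * m.
    rewrite mulnCA -mulnA leq_mul //; apply: leq_trans wide.
    by rewrite leq_mul //; lia.
  have dE : Q * 63 * (8 - r) * m = Q * 63 * (8 - r.+1) * m + Q * 63 * m.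
    by rewrite -mulnDl -mulnSr subnSK // (ltn_trans r4).
  by move: sumN; rewrite dE /N mulnDr; lia.
elim=> [|k IHk]; elim=> [|r IHr] r4.
- by rewrite muln0 addn0 expn0; lia.
- exact: step r4 (IHr (ltnW r4)).
(* From [r = 4] at [k] to [r = 0] at [k.+1] neither the threshold nor the slack changes, as
   [4 / 2 ^ k = 8 / 2 ^ k.+1]. *)
- rewrite addn0 mulnS addnC => /(IHk 4 (leqnn 4)).
  by rewrite expnS; lia.
- exact: step r4 (IHr (ltnW r4)).
Qed.

(** * Drawing all pieces and passing to voxels *)

Lemma piece_drawable (G : sgraph) (bag : G -> {set G}) (B : btree G) (M : nat) :
  uniq (nodes B) -> (forall x, x \in nodes B) -> separated bag set0 B ->
  (forall x, x \in bag x) -> (forall x, #|bag x| <= M) ->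
  forall P : {set G}, is_piece B P ->
  exists w h n, drawable bag (4 * M) P w h n /\ small_drawing (4 * M) #|P| w h n.
Proof.
move=> uB fB sB mem_bag bagM P; have [k] := ubnP #|P|.
elim: k P => // k IH P /ltnSE le_Pk pP.
case: (eqVneq P set0) => [->|P0].
  by exists 0, 0, 0; split; [apply: drawable0 | rewrite cards0; apply: small_drawing0].
have [own [Ps [[own2 Ps5 ownP] PsP Pcover sizes sep]]] := piece_split uB sB pP P0.
have P_gt0 : 0 < #|P| by rewrite card_gt0.
have IHd (A : {set G}) : exists d : nat * nat * nat, A \in Ps ->
    drawable bag (4 * M) A d.1.1 d.1.2 d.2 /\ small_drawing (4 * M) #|A| d.1.1 d.1.2 d.2.
  case: (boolP (A \in Ps)) => [APs|_]; last by exists (0, 0, 0).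
  have [pA _ halfA _] := PsP A APs.
  have [|w [h [n dA]]] := IH A _ pA; first by apply: leq_trans le_Pk; lia.
  by exists (w, h, n).
have /fin_all_exists[d dP] := IHd.
(* The boundary has at most [2 M] elements and the bags of at most two removed nodes have another
   [2 M]; hence [4 M] colours. *)
have XQ : #|boundary bag P :|: occ bag own| <= 4 * M.
  apply: leq_trans (leq_card_setU _ _) _.
  have -> : 4 * M = (M + M) + 2 * M by lia.
  apply: leq_add; first exact: piece_boundary pP.
  have occ_own l : #|occ bag l| <= size l * M.
    elim: l => [|x l IHl]; first by rewrite /occ big_nil cards0.
    by rewrite occ_cons /= mulSn (leq_trans (leq_card_setU _ _)) // leq_add.
  by apply: leq_trans (occ_own own) _; rewrite leq_mul //; case/andP: own2.
have drP A APs := proj1 (dP A APs); have smallP A APs := proj2 (dP A APs).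
have dr := drawable_node (w := fun A => (d A).1.1) (h := fun A => (d A).1.2)
  (n := fun A => (d A).2) mem_bag ownP _ Pcover sep XQ drP.
have sm := small_drawing_node (m' := fun A : {set G} => #|A|) (w := fun A => (d A).1.1)
  (h := fun A => (d A).1.2) (n := fun A => (d A).2) P_gt0 _ Ps5 (ltnW sizes) _ smallP.
do 3!eexists; split.
  by apply: dr => A /PsP[].
by apply: sm => [|A /PsP[]//]; case/andP: own2.
Qed.

Definition voxel_of (a : cell) : voxel := (Posz a.1.1, Posz a.1.2, Posz a.2).

Lemma voxel_of_inj : injective voxel_of.
Proof. by move=> [[x y] z] [[x' y'] z'] [-> -> ->]. Qed.

Lemma voxel_adj_near a b : voxel_adj (voxel_of a) (voxel_of b) = near a b.
Proof. by rewrite /voxel_adj /near /=; congr (_ == _); lia. Qed.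

Theorem theorem11 :
  exists C : nat, 0 < C /\
    forall (n tau : nat), 1 <= n -> 1 <= tau ->
    forall G : sgraph, #|G| = n -> is_treewidth G tau ->
    exists B : G -> {fset voxel},
      voxel_representation B /\ representation_size B <= C * n * tau.
Proof.
(* With [M = 2 (tau + 1)] there are [4 M = 8 (tau + 1) <= 16 tau] colours [Q], and the size is at
   most [504 Q n]. *)
exists (504 * 16); split=> // n tau n_gt0 tau_gt0 G cG [[D wD] _].
have [bag [t [[ut ft] st mem_bag bag_le bag_edge]]] := binary_decomposition D.
have piece_t : is_piece t [set: G] by apply: piece_full.
(* The slack is dropped in the end, so any [k] with [n < 2 ^ (4 * k)] serves, for instance
   [k = n]. *)
have [w [h [sz [dr [_ _ /(_ n 0 isT)]]]]] := piece_drawable ut ft st mem_bag bag_le piece_t.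
rewrite cardsT cG addn0 wD => szP.
have {szP} sz_le : sz <= 504 * 16 * n * tau.
  have lt_n : n < 2 ^ (4 * n).
    by apply: leq_trans (ltn_expl n (isT : 1 < 2)) _; rewrite leq_exp2l //; lia.
  have := leq_trans (leq_addr _ _) (szP lt_n).
  have K0 : 0 < 2 ^ n by rewrite expn_gt0.
  rewrite -[_ * 2 ^ n]mulnC -[_ * n]mulnA leq_pmul2l // => /leq_trans; apply.
  have : n * tau.+1 <= n * (2 * tau) by rewrite leq_mul //; lia.
  by lia.
have bd0 u : u \in boundary bag [set: G] = false.
  apply/negP; rewrite inE => /andP[_ /occP[x]].
  by rewrite mem_enum !inE.
(* The boundary of the whole vertex set is empty, so a constant map is a valid colouring. *)
have [||f [df _ f0 fT szf]] := dr (fun=> 0).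
- by move=> u v; rewrite bd0.
- by move=> u; rewrite bd0.
pose B v := [fset a in map voxel_of (f v)]%fset.
have memB v a : reflect (exists2 b, b \in f v & a = voxel_of b) (a \in B v).
  by rewrite /B inE; apply: mapP.
have touchB u v : blobs_touch (B u) (B v) <-> touches f u v.
  split=> [[_ [_ [/memB[a af ->] /memB[b bf ->]]]]|[a [b [af bf nab]]]].
    by rewrite voxel_adj_near => nab; exists a, b.
  exists (voxel_of a), (voxel_of b); rewrite voxel_adj_near; split=> //.
    by apply/memB; exists a.
  by apply/memB; exists b.
exists B; split; last first.
  apply: leq_trans sz_le; apply: leq_trans szf.
  apply: leq_sum => v _; rewrite card_fseq.
  by apply: leq_trans (size_undup _) _; rewrite size_map.
split.
- move=> v; split.
    have : f v != [::] by apply: f0; rewrite inE.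
    case E: (f v) => [//|a s] _; apply/eqP => B0.
    have : voxel_of a \in B v by apply/memB; exists a; rewrite // E inE eqxx.
    by rewrite B0 inE.
  move=> _ _ /memB[a af ->] /memB[b bf ->].
  have [p [pP ps <-]] := drawing_joined df af bf.
  exists (map voxel_of p); split; last by rewrite last_map.
    by rewrite path_map; apply: sub_path pP => x y /=; rewrite voxel_adj_near.
  by move=> _ /mapP[x /ps xf ->]; apply/memB; exists x.
- move=> u v uv; apply/fdisjointP => _ /memB[a af ->]; apply/negP => /memB[b bf].
  by move/voxel_of_inj => E; have := drawing_disjoint df uv af; rewrite E bf.
- move=> u v uv; split; first by move/touchB; apply: (drawing_touch df uv).
  move=> euv; apply/touchB; case/orP: (bag_edge u v euv) => ub.
    rewrite edge_sym in euv.
    have [a [b [av bu nab]]] := fT v u (in_setT v) ub euv.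
    by exists b, a; rewrite near_sym.
  by apply: fT euv => //; rewrite inE.
Qed.
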